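(* For $i\in I$, $m\in\mathbb Z$ and $\mathbf u=\bigotimes^{\to}_{k\in\mathbb Z}u_k\in\mathscr U_{\mathbb Z}$ with homogeneous $u_k$, write $x=\mathbf u_{>m+1}$, $y=u_{m+1}$, $z=u_m$, $w=\mathbf u_{<m}$, so that $\mathbf u=x\otimes y\otimes z\otimes w$. Then the assignment $$f_{i,m}(\mathbf u)=q^{(\alpha_{i,m},\,\widehat{\mathrm{wt}}(x\otimes y))}\Big(-(1-q_i^{-2})\,x\otimes e_i^*(y)\otimes z\otimes w+x\otimes y\otimes f_iz\otimes w\Big)$$ (extended linearly) gives an $\widehat{\mathcal A}$-module structure on $\mathscr U_{\mathbb Z}$.
   Context: Root data. $C=(c_{i,j})_{i,j\in I}$ is a symmetrizable generalized Cartan matrix with weight lattice $P$, simple roots $\alpha_i\in P$, simple coroots $h_i\in \mathrm{Hom}_{\mathbb Z}(P,\mathbb Z)$, $\langle h_i,\alpha_j\rangle=c_{i,j}$, and a symmetric $\mathbb Q$-valued bilinear form $(\ ,\ )$ on $P$ with $(\alpha_i,\alpha_i)\in2\mathbb Z_{>0}$ and $\langle h_i,\lambda\rangle=2(\alpha_i,\lambda)/(\alpha_i,\alpha_i)$. $Q=\bigoplus_i\mathbb Z\alpha_i$. $q$ is an indeterminate with square root $q^{1/2}$; $q_i=q^{(\alpha_i,\alpha_i)/2}$, $[n]_i=(q_i^n-q_i^{-n})/(q_i-q_i^{-1})$, with the usual binomials $\begin{bmatrix}m\\ n\end{bmatrix}_i$. Put $\alpha_{i,m}=(-1)^m\alpha_i$.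 $U_q^-(\mathfrak g)$ is the $\mathbb Q(q)$-algebra generated by the Chevalley generators $f_i$ of the negative half of the quantum group (quantum Serre relations), graded by $\mathrm{wt}(f_i)=-\alpha_i$; $U^-_{q^{1/2}}(\mathfrak g)=\mathbb Q(q^{1/2})\otimes U_q^-(\mathfrak g)$. The linear operator $e_i^*$ on it is determined by $e_i^*(1)=0$, $e_i^*(f_j)=\delta_{i,j}$ and $e_i^*(xy)=x\,e_i^*(y)+q^{(\alpha_i,\mathrm{wt}(y))}e_i^*(x)y$ for homogeneous $x,y$. $\widehat{\mathcal A}$ is the $\mathbb Q(q^{1/2})$-algebra generated by $f_{i,p}$ ($i\in I,p\in\mathbb Z$) with relations: (a) $\sum_{k=0}^{1-\langle h_i,\alpha_j\rangle}(-1)^k\begin{bmatrix}1-\langle h_i,\alpha_j\rangle\\k\end{bmatrix}_if_{i,p}^kf_{j,p}f_{i,p}^{1-\langle h_i,\alpha_j\rangle-k}=0$ for $i\ne j$, $p\in\mathbb Z$; (b) $f_{i,m}f_{j,p}=q^{(-1)^{p-m+1}(\alpha_i,\alpha_j)}f_{j,p}f_{i,m}+\delta_{(j,p),(i,m+1)}(1-q_i^2)$ if $m<p$. The space $\mathscr U_{\mathbb Z}$. For $k\in\mathbb Z$ let $U^-_{q^{1/2}}(\mathfrak g)_k$ be a copy of $U^-_{q^{1/2}}(\mathfrak g)$. For $a\le b$ put $\mathscr U_{\mathbb Z}[a,b]=U^-_{q^{1/2}}(\mathfrak g)_b\otimes U^-_{q^{1/2}}(\mathfrak g)_{b-1}\otimes\cdots\otimes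 U^-_{q^{1/2}}(\mathfrak g)_a$ (over $\mathbb Q(q^{1/2})$); for $a\le a'\le b'\le b$ embed $\mathscr U_{\mathbb Z}[a',b']$ in $\mathscr U_{\mathbb Z}[a,b]$ by inserting $1$ in the additional tensor factors; $\mathscr U_{\mathbb Z}=\bigcup_{a\le b}\mathscr U_{\mathbb Z}[a,b]$. Elements are sums of $\mathbf u=\bigotimes^{\to}_{k\in\mathbb Z}u_k$ (index decreasing from left to right), with $u_k\in U^-_{q^{1/2}}(\mathfrak g)_k$ and $u_k=1$ for all but finitely many $k$; $\mathbf u_{>m}=\bigotimes^{\to}_{k>m}u_k$, $\mathbf u_{<m}=\bigotimes^{\to}_{k<m}u_k$. For a tensor with homogeneous factors, $\widehat{\mathrm{wt}}(\mathbf u)=\sum_k(-1)^k\mathrm{wt}(u_k)$, where the sum is over the indices $k$ occurring in the (partial) tensor; thus $\widehat{\mathrm{wt}}(x\otimes y)=\sum_{k\ge m+1}(-1)^k\mathrm{wt}(u_k)$. *)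

(* Defs.v *)
From HB Require Import structures.
From mathcomp Require Import all_boot all_order all_algebra.
From mathcomp Require Import fraction generic_quotient.
From mathcomp Require Import ring boolp finmap.
From mathcomp.multinomials Require Import monalg.

Set Implicit Arguments.
Unset Strict Implicit.
Unset Printing Implicit Defensive.

Import Order.TTheory GRing.Theory Num.Theory.
Local Open Scope ring_scope.
Local Open Scope quotient_scope.

Record submodule (K : nzRingType) (V : lmodType K) := Submodule {
  in_sub :> V -> Prop;
  _ : in_sub 0;
  _ : forall a x y, in_sub x -> in_sub y -> in_sub (a *: x + y)
}.

Section ModuleQuotient.
Variables (K : nzRingType) (V : lmodType K) (W : submodule V).

Lemma smod0 : W 0. Proof. by case: W. Qed.
Lemma smodP a x y : W x -> W y -> W (a *: x + y).
Proof. by case: W => ? ? h; exact: h. Qed.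
Lemma smodD x y : W x -> W y -> W (x + y).
Proof. by rewrite -{2}[x]scale1r; exact: smodP. Qed.
Lemma smodZ a x : W x -> W (a *: x).
Proof. by rewrite -[a *: x]addr0 => h; apply: smodP => //; exact: smod0. Qed.
Lemma smodN x : W x -> W (- x).
Proof. by rewrite -scaleN1r; exact: smodZ. Qed.
Lemma smod_sum (J : Type) (r : seq J) (F : J -> V) :
  (forall j, W (F j)) -> W (\sum_(j <- r) F j).
Proof.
by move=> h; elim/big_ind: _ => //; [exact: smod0 | exact: smodD].
Qed.

Definition qrel (x y : V) : bool := `[< W (x - y) >].

Lemma qrel_refl : reflexive qrel.
Proof. by move=> x; apply/asboolP; rewrite subrr; exact: smod0. Qed.
Lemma qrel_sym : symmetric qrel.
Proof.
by move=> x y; apply/asboolP/asboolP => /smodN; rewrite opprB.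
Qed.
Lemma qrel_trans : transitive qrel.
Proof.
move=> y x z /asboolP h1 /asboolP h2; apply/asboolP.
by rewrite -(subrKA y); exact: smodD.
Qed.

Canonical qrel_equiv := EquivRel qrel qrel_refl qrel_sym qrel_trans.

Definition quot := {eq_quot qrel_equiv}.

HB.instance Definition _ := Choice.on quot.
HB.instance Definition _ := EqQuotient.on quot.

Definition qpi (x : V) : quot := \pi_quot x.

Lemma qpiP (x y : V) : qpi x = qpi y <-> W (x - y).
Proof.
split; first by move/eqmodP/asboolP.
by move=> h; apply/eqmodP/asboolP.
Qed.

Lemma qpi_repr (x : quot) : qpi (repr x) = x.
Proof. exact: reprK. Qed.

Lemma qpi_surj (x : quot) : exists y, x = qpi y.
Proof. by exists (repr x); rewrite qpi_repr. Qed.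

Definition qzero : quot := qpi 0.
Definition qopp (x : quot) : quot := locked (qpi (- repr x)).
Definition qadd (x y : quot) : quot := locked (qpi (repr x + repr y)).
Definition qscale (a : K) (x : quot) : quot := locked (qpi (a *: repr x)).

Lemma repr_qpi (x : V) : W (repr (qpi x) - x).
Proof. by apply/qpiP; rewrite qpi_repr. Qed.

Lemma qoppE x : qopp (qpi x) = qpi (- x).
Proof. by rewrite /qopp -lock; apply/qpiP; rewrite -opprD; apply: smodN; exact: repr_qpi. Qed.
Lemma qaddE x y : qadd (qpi x) (qpi y) = qpi (x + y).
Proof.
rewrite /qadd -lock; apply/qpiP; rewrite opprD addrACA.
by apply: smodD; exact: repr_qpi.
Qed.
Lemma qscaleE a x : qscale a (qpi x) = qpi (a *: x).
Proof.
by rewrite /qscale -lock; apply/qpiP; rewrite -scalerBr; apply: smodZ; exact: repr_qpi.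
Qed.

Lemma qaddA : associative qadd.
Proof.
move=> x y z; have [[x' ->] [y' ->] [z' ->]] :=
  And3 (qpi_surj x) (qpi_surj y) (qpi_surj z).
by rewrite !qaddE addrA.
Qed.
Lemma qaddC : commutative qadd.
Proof. by move=> x y; rewrite /qadd addrC. Qed.
Lemma qadd0 : left_id qzero qadd.
Proof. by move=> x; have [x' ->] := qpi_surj x; rewrite qaddE add0r. Qed.
Lemma qaddN : left_inverse qzero qopp qadd.
Proof.
by move=> x; have [x' ->] := qpi_surj x; rewrite qoppE qaddE addNr.
Qed.

HB.instance Definition _ := GRing.isZmodule.Build quot
  qaddA qaddC qadd0 qaddN.

Lemma qaddDE (x y : quot) : x + y = qadd x y. Proof. by []. Qed.
Lemma qscaleA a b x : qscale a (qscale b x) = qscale (a * b) x.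
Proof. by have [x' ->] := qpi_surj x; rewrite !qscaleE scalerA. Qed.
Lemma qscale1 : left_id 1 qscale.
Proof. by move=> x; have [x' ->] := qpi_surj x; rewrite qscaleE scale1r. Qed.
Lemma qscaleDr : right_distributive qscale +%R.
Proof.
move=> a x y; have [[x' ->] [y' ->]] := conj (qpi_surj x) (qpi_surj y).
by rewrite !qaddDE qaddE !qscaleE qaddE scalerDr.
Qed.
Lemma qscaleDl x : {morph qscale^~ x : a b / a + b}.
Proof.
move=> a b; have [x' ->] := qpi_surj x.
by rewrite qaddDE !qscaleE qaddE scalerDl.
Qed.

HB.instance Definition _ := GRing.Zmodule_isLmodule.Build K quot
  qscaleA qscale1 qscaleDr qscaleDl.

Lemma qpi_is_linear : linear qpi.
Proof.
move=> a x y; rewrite qaddDE.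
by rewrite -[a *: qpi x]/(qscale a (qpi x)) qscaleE qaddE.
Qed.
HB.instance Definition _ := GRing.isLinear.Build K V quot _ qpi qpi_is_linear.

Lemma qpi_eq0 x : qpi x = 0 <-> W x.
Proof. by rewrite -(linear0 qpi) qpiP subr0. Qed.

Section Lift.
Variables (M : lmodType K) (phi : {linear V -> M}).
Hypothesis phiW : forall x, W x -> phi x = 0.

Definition qlift_fun (x : quot) : M := phi (repr x).

Lemma qlift_funE x : qlift_fun (qpi x) = phi x.
Proof.
by apply/eqP; rewrite -subr_eq0 -linearB /= phiW //; exact: repr_qpi.
Qed.

Lemma qlift_linear : linear qlift_fun.
Proof.
move=> a x y; have [[x' ->] [y' ->]] := conj (qpi_surj x) (qpi_surj y).
by rewrite -linearP !qlift_funE linearP.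
Qed.

Lemma qlift_exists : exists e : {linear quot -> M}, forall x, e (qpi x) = phi x.
Proof.
pose L := GRing.isLinear.Build K quot M _ qlift_fun qlift_linear.
pose e : {linear quot -> M} := HB.pack qlift_fun L.
by exists e => x; exact: qlift_funE.
Qed.

End Lift.

End ModuleQuotient.

Section Span.
Variables (K : nzRingType) (V : lmodType K) (S : V -> Prop).

Inductive in_spanned : V -> Prop :=
| in_spanned0 : in_spanned 0
| in_spannedP a x y : S x -> in_spanned y -> in_spanned (a *: x + y).

Lemma in_spanned_comb a x y : in_spanned x -> in_spanned y -> in_spanned (a *: x + y).
Proof.
elim=> [|b s z Ss _ IH] hy; first by rewrite scaler0 add0r.
by rewrite scalerDr scalerA -addrA; apply: in_spannedP => //; exact: IH.
Qed.

Definition spanned : submodule V := Submodule in_spanned0 in_spanned_comb.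

End Span.

Section TwistedDerivations.
Variables (K : fieldType) (A : lalgType K).
Hypothesis scaleAr : forall a (x y : A), a *: (x * y) = x * (a *: y).

Lemma twist_step (g u v du dv : A) (a b c : K) :
  g * (u * dv + b *: (du * v)) + c *: ((a * b) *: (u * v)) =
  g * u * dv + b *: ((g * du + c *: (a *: u)) * v).
Proof.
rewrite mulrDr mulrA -addrA -scaleAr mulrA; congr (_ + _).
rewrite mulrDl scalerDr -!scalerAl !scalerA; congr (_ + _ *: _).
by rewrite mulrA mulrC.
Qed.

Variables (d : {linear A -> A}) (T : choiceType) (r : seq T).
Variables (a : T -> K) (x : T -> A).

Let dZ b z : d (b *: z) = b *: d z. Proof. exact: linearZ. Qed.

Lemma twist_suml (y dy : A) (c : K) :
  (forall u, d (x u * y) = x u * dy + c *: (d (x u) * y)) ->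
  d ((\sum_(u <- r) a u *: x u) * y) =
  (\sum_(u <- r) a u *: x u) * dy + c *: (d (\sum_(u <- r) a u *: x u) * y).
Proof.
move=> h; rewrite !mulr_suml !(linear_sum d) mulr_suml /= scaler_sumr -big_split /=.
apply: eq_bigr => u _; rewrite -!scalerAl !dZ h scalerDr.
by rewrite -scalerAl !scalerA (mulrC c).
Qed.

Lemma twist_sumr (z dz : A) (c : K) :
  {in r, forall u, d (z * x u) = z * d (x u) + c *: (dz * x u)} ->
  d (z * (\sum_(u <- r) a u *: x u)) =
  z * d (\sum_(u <- r) a u *: x u) + c *: (dz * (\sum_(u <- r) a u *: x u)).
Proof.
move=> h; rewrite !mulr_sumr !(linear_sum d) mulr_sumr /= scaler_sumr -big_split /=.
rewrite !big_seq; apply: eq_bigr => u hu.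
by rewrite -!scaleAr !dZ h // scalerDr -!scaleAr !scalerA (mulrC c).
Qed.

End TwistedDerivations.

Section SerreSums.
Variables (K : fieldType).

Lemma twist_aux (A : lalgType K)
  (scaleAr : forall a (x y : A), a *: (x * y) = x * (a *: y))
  (u g x y z w : A) (a b c : K) :
  u * (g * (a *: x) + 0 *: y) + c *: ((b *: z) * w) =
  a *: (u * (g * x)) + (c * b) *: (z * w).
Proof. by rewrite scale0r addr0 -!scaleAr -scalerAl scalerA. Qed.

Lemma scale_comb (V : lmodType K) (a b c : K) (x y : V) :
  c *: (a *: x + b *: y) = (c * a) *: x + (c * b) *: y.
Proof. by rewrite scalerDr !scalerA. Qed.

Lemma shift_sum (V : lmodType K) m (c d : nat -> K) (x y : nat -> V) :
  c m.+1 = 0 -> d 0%N = 0 ->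
  (forall k, (k <= m)%N -> x k = y k.+1 /\ c k + d k.+1 = 0) ->
  \sum_(k < m.+2) (c k *: x k + d k *: y k) = 0.
Proof.
move=> c0 d0 h.
rewrite big_split /= big_ord_recr [X in _ + X]big_ord_recl /= c0 d0 !scale0r.
rewrite addr0 add0r -big_split /=; apply: big1 => -[k km] _ /=.
by rewrite /bump /= add1n; have [-> cd] := h k km; rewrite -scalerDl cd scale0r.
Qed.

End SerreSums.


Section FreeAlgebra.
Variables (K : fieldType) (G : choiceType).

Lemma malgC_comm c (x : {malg K[{fmonom G}]}) : c%:MP * x = x * c%:MP.
Proof.
rewrite !malgM_def fgmulUg fgmulgU; apply: eq_bigr => k _.
by rewrite mul1m mulm1 mulrC.
Qed.

Lemma malg_scalerAr c (x y : {malg K[{fmonom G}]}) : c *: (x * y) = x * (c *: y).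
Proof. by rewrite -!mul_malgC !mulrA malgC_comm. Qed.

End FreeAlgebra.

Notation freealg K G := {malg K[{fmonom G}]} (only parsing).

Section Presentation.
Variables (K : fieldType) (G : choiceType).
Local Notation freealg := (freealg K G).

Definition gen (g : G) : freealg := << fmu g >>.

Variable R : freealg -> Prop.

Inductive in_ideal : freealg -> Prop :=
| in_ideal0 : in_ideal 0
| in_idealP x r y z : R r -> in_ideal z -> in_ideal (x * r * y + z).

Lemma in_idealD x y : in_ideal x -> in_ideal y -> in_ideal (x + y).
Proof.
elim=> [|a r b z Rr _ IH] hy; first by rewrite add0r.
by rewrite -addrA; apply: in_idealP => //; exact: IH.
Qed.
Lemma in_idealMl a x : in_ideal x -> in_ideal (a * x).
Proof.
elim=> [|b r c z Rr _ IH]; first by rewrite mulr0; exact: in_ideal0.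
by rewrite mulrDr !mulrA; exact: in_idealP.
Qed.
Lemma in_idealMr a x : in_ideal x -> in_ideal (x * a).
Proof.
elim=> [|b r c z Rr _ IH]; first by rewrite mul0r; exact: in_ideal0.
by rewrite mulrDl -!mulrA (mulrA b); exact: in_idealP.
Qed.
Lemma in_ideal_comb a x y :
  in_ideal x -> in_ideal y -> in_ideal (a *: x + y).
Proof.
move=> hx; apply: in_idealD.
by rewrite -[x]mul1r scalerAl; exact: in_idealMl.
Qed.

Definition ideal : submodule freealg := Submodule in_ideal0 in_ideal_comb.

Definition palg := quot ideal.
HB.instance Definition _ := GRing.Lmodule.on palg.

Definition ppi : freealg -> palg := @qpi _ _ ideal.
HB.instance Definition _ := GRing.Linear.on ppi.

Lemma ppiP x y : ppi x = ppi y <-> in_ideal (x - y).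
Proof. exact: qpiP. Qed.
Lemma ppi_surj (x : palg) : exists y, x = ppi y.
Proof. exact: qpi_surj. Qed.

Definition pone : palg := ppi 1.
Definition pmul (x y : palg) : palg := locked (ppi (repr x * repr y)).

Lemma pmulE x y : pmul (ppi x) (ppi y) = ppi (x * y).
Proof.
rewrite /pmul -lock; apply/ppiP; have hx : in_ideal _ := repr_qpi ideal x.
have hy : in_ideal _ := repr_qpi ideal y.
have -> : repr (ppi x) * repr (ppi y) - x * y =
  repr (ppi x) * (repr (ppi y) - y) + (repr (ppi x) - x) * y.
  by rewrite mulrBr mulrBl subrKA.
by apply: in_idealD; [exact: in_idealMl | exact: in_idealMr].
Qed.

Lemma pmulA : associative pmul.
Proof.
move=> x y z; have [[x' ->] [y' ->] [z' ->]] :=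
  And3 (ppi_surj x) (ppi_surj y) (ppi_surj z).
by rewrite !pmulE mulrA.
Qed.
Lemma pmul1 : left_id pone pmul.
Proof. by move=> x; have [x' ->] := ppi_surj x; rewrite pmulE mul1r. Qed.
Lemma pmulr1 : right_id pone pmul.
Proof. by move=> x; have [x' ->] := ppi_surj x; rewrite pmulE mulr1. Qed.
Lemma pmulDl : left_distributive pmul +%R.
Proof.
move=> x y z; have [[x' ->] [y' ->] [z' ->]] :=
  And3 (ppi_surj x) (ppi_surj y) (ppi_surj z).
by rewrite -linearD !pmulE -linearD mulrDl.
Qed.
Lemma pmulDr : right_distributive pmul +%R.
Proof.
move=> x y z; have [[x' ->] [y' ->] [z' ->]] :=
  And3 (ppi_surj x) (ppi_surj y) (ppi_surj z).
by rewrite -linearD !pmulE -linearD mulrDr.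
Qed.

(* Only pzRingType: 1 = 0 is not excluded for arbitrary relators. *)
HB.instance Definition _ := GRing.Zmodule_isPzRing.Build palg
  pmulA pmul1 pmulr1 pmulDl pmulDr.

Lemma ppiM x y : ppi (x * y) = ppi x * ppi y.
Proof. by rewrite [RHS]pmulE. Qed.
Lemma ppi1 : ppi 1 = 1. Proof. by []. Qed.

Lemma ppiZ a x : ppi (a *: x) = a *: ppi x.
Proof. exact: linearZ. Qed.

Lemma palg_scalerAl a (x y : palg) : a *: (x * y) = (a *: x) * y.
Proof.
have [[x' ->] [y' ->]] := conj (ppi_surj x) (ppi_surj y).
by rewrite -!ppiM -!ppiZ -!ppiM scalerAl.
Qed.
Lemma palg_scalerAr a (x y : palg) : a *: (x * y) = x * (a *: y).
Proof.
have [[x' ->] [y' ->]] := conj (ppi_surj x) (ppi_surj y).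
by rewrite -!ppiM -!ppiZ -!ppiM malg_scalerAr.
Qed.

Definition pgen (g : G) : palg := ppi (gen g).

End Presentation.

Section LinearExtension.
Variables (K : nzRingType) (G : choiceType) (V : lmodType K) (h : G -> V).

Definition lext (X : {malg K[G]}) : V := \sum_(k <- msupp X) X@_k *: h k.

Lemma lextEw (d : {fset G}) X :
  (msupp X `<=` d)%fset -> lext X = \sum_(k <- d) X@_k *: h k.
Proof.
move=> le; rewrite [LHS](big_fset_incl _ le) => //= x xd /mcoeff_outdom ->.
by rewrite scale0r.
Qed.

Lemma lext_linear : linear lext.
Proof.
move=> a X Y /=; pose d := (msupp X `|` msupp Y `|` msupp (a *: X + Y))%fset.
have hX : (msupp X `<=` d)%fset by apply/fsubsetP => k hk; rewrite /d !inE hk.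
have hY : (msupp Y `<=` d)%fset.
  by apply/fsubsetP => k hk; rewrite /d !inE hk orbT.
have hXY : (msupp (a *: X + Y) `<=` d)%fset.
  by apply/fsubsetP => k hk; rewrite /d inE hk orbT.
rewrite (lextEw hX) (lextEw hY) (lextEw hXY).
rewrite scaler_sumr -big_split /=; apply: eq_bigr => k _.
by rewrite mcoeffD mcoeffZ scalerDl scalerA.
Qed.
HB.instance Definition _ :=
  GRing.isLinear.Build K {malg K[G]} V _ lext lext_linear.

Lemma lextU c k : lext << c *g k >> = c *: h k.
Proof. by rewrite (lextEw msuppU_le) big_seq_fset1 mcoeffUU. Qed.

Lemma malgU_scale c (k : G) : << c *g k >> = c *: << k >> :> {malg K[G]}.
Proof. by apply/malgP => l; rewrite mcoeffZ !mcoeffU mulrnAr mulr1. Qed.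

Lemma malg_decomp (X : {malg K[G]}) : X = \sum_(k <- msupp X) X@_k *: << k >>.
Proof. by rewrite {1}[X]monalgE; apply: eq_bigr => k _; rewrite malgU_scale. Qed.

End LinearExtension.

Record symmetrizable_gcm (I : Type) (C : I -> I -> int) : Prop := SymGCM {
  gcm_diag : forall i, C i i = 2;
  gcm_offdiag : forall i j, i <> j -> C i j <= 0;
  gcm_zero : forall i j, C i j = 0 -> C j i = 0;
  gcm_sym : exists d : I -> int,
    (forall i, 0 < d i) /\ (forall i j, d i * C i j = d j * C j i)
}.

Record root_datum (I : choiceType) := RootDatum {
  cartan : I -> I -> int;
  cartanP : symmetrizable_gcm cartan;
  weight : zmodType;
  weight_free : exists (B : choiceType) (phi : {additive {malg int[B]} -> weight}),
    bijective phi;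
  simple_root : I -> weight;
  (* so that Q, the direct sum of the Z alpha_i, is a subgroup of P *)
  root_indep : forall c : {malg int[I]},
    \sum_(i <- msupp c) simple_root i *~ c@_i = 0 -> c = 0;
  simple_coroot : I -> {additive weight -> int};
  coroot_root : forall i j, simple_coroot i (simple_root j) = cartan i j;
  wform : weight -> weight -> rat;
  formC : forall x y, wform x y = wform y x;
  formDl : forall x y z, wform (x + y) z = wform x z + wform y z;
  form_root : forall i, exists2 n : nat, (0 < n)%N &
    wform (simple_root i) (simple_root i) = (2 * n)%:R;
  coroot_form : forall i x,
    (simple_coroot i x)%:~R =
    2 * wform (simple_root i) x / wform (simple_root i) (simple_root i)
}.

Section QNumbers.
Variables (F : fieldType) (Q : F).

Definition qnum (n : nat) : F := (Q ^+ n - Q ^- n) / (Q - Q^-1).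
Definition qfact (n : nat) : F := \prod_(1 <= k < n.+1) qnum k.
(* Only used for n <= m. *)
Definition qbin (m n : nat) : F := qfact m / (qfact n * qfact (m - n)).

Hypothesis Q0 : Q != 0.
Hypothesis Qn : forall n, (0 < n)%N -> Q ^+ n != 1.

Lemma qden_neq0 : Q - Q^-1 != 0.
Proof.
rewrite subr_eq0; apply/eqP => h; have := Qn (isT : (0 < 2)%N).
by rewrite expr2 {1}h mulVf // eqxx.
Qed.

Lemma qnum_neq0 n : (0 < n)%N -> qnum n != 0.
Proof.
move=> n0; rewrite mulf_neq0 ?invr_eq0 ?qden_neq0 //.
rewrite subr_eq0; apply/eqP => h.
have := Qn (n := (n + n)%N); rewrite addn_gt0 n0 => /(_ isT).
by rewrite exprD {1}h mulVf ?eqxx // expf_neq0.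
Qed.

Lemma qfact_neq0 n : qfact n != 0.
Proof.
rewrite /qfact big_nat_cond prodf_seq_neq0.
by apply/allP => k _; apply/implyP => /andP[/andP[k0 _] _]; exact: qnum_neq0.
Qed.

Lemma qfactS n : qfact n.+1 = qfact n * qnum n.+1.
Proof. by rewrite /qfact big_nat_recr. Qed.

Lemma qfact0 : qfact 0 = 1. Proof. by rewrite /qfact big_geq. Qed.
Lemma qbin0 n : qbin n 0 = 1.
Proof. by rewrite /qbin qfact0 mul1r subn0 divff ?qfact_neq0. Qed.
Lemma qbinn n : qbin n n = 1.
Proof. by rewrite /qbin subnn qfact0 mulr1 divff ?qfact_neq0. Qed.

Lemma qbin_shift n k : (k < n)%N ->
  qbin n k * qnum (n - k) = qbin n k.+1 * qnum k.+1.
Proof.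
move=> kn; rewrite /qbin qfactS -(subnSK kn) qfactS.
set a := qfact k; set b := qfact (n - k.+1); set c := qnum _.
set d := qnum k.+1.
have [ha hb] : a != 0 /\ b != 0 by rewrite !qfact_neq0.
have [hc hd] : c != 0 /\ d != 0 by rewrite !qnum_neq0.
by field; rewrite ha hb hc hd.
Qed.

Lemma qbin_pascal n k : (k < n)%N ->
  qbin n.+1 k.+1 = Q ^- k.+1 * qbin n k.+1 + Q ^+ (n - k) * qbin n k.
Proof.
move=> kn; rewrite /qbin subSS qfactS (qfactS k) -(subnSK kn) (qfactS (n - _)).
have hn : qnum n.+1 = Q ^- k.+1 * qnum (n - k.+1).+1
                      + Q ^+ (n - k.+1).+1 * qnum k.+1.
  have -> : n.+1 = (k.+1 + (n - k.+1).+1)%N by rewrite addnS subnKC.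
  rewrite /qnum !exprD; move: (expf_neq0 k.+1 Q0).
  move: (expf_neq0 (n - k.+1).+1 Q0) qden_neq0.
  move: (Q ^+ k.+1) (Q ^+ (n - k.+1).+1) (Q - Q^-1) => x y z hy hz hx.
  by field; rewrite hx hy hz.
rewrite hn; set x := Q ^- k.+1; set y := Q ^+ (n - k.+1).+1.
set a := qfact k; set b := qfact (n - k.+1); set c := qnum _.
set d := qnum k.+1; set e := qfact n.
have [ha hb] : a != 0 /\ b != 0 by rewrite !qfact_neq0.
have [hc hd] : c != 0 /\ d != 0 by rewrite !qnum_neq0.
by field; rewrite ha hb hc hd.
Qed.

Lemma qbin_alt_sum n :
  \sum_(k < n.+2) (-1) ^+ k * qbin n.+1 k * Q ^+ ((n.+1 - k) * n) = 0.
Proof.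
pose g k := (-1) ^+ k * Q ^+ ((n - k) * n.+1) * qbin n k.
rewrite big_ord_recl big_ord_recr /= qbin0 /bump /= !add1n qbinn subnn mul0n.
rewrite (eq_bigr (fun k : 'I_n => g k.+1 - g k)); last first.
  move=> [k kn] _ /=; rewrite /bump add1n /g qbin_pascal // subSS.
  rewrite [((n - k) * n.+1)%N]mulnS [Q ^+ (n - k + _)]exprD.
  have -> : ((n - k) * n = (n - k.+1) * n.+1 + k.+1)%N.
    by rewrite -(subnSK kn) mulSn mulnS addnAC subnK.
  rewrite exprD exprS; move: (expf_neq0 k.+1 Q0).
  move: (Q ^+ k.+1) (Q ^+ (n - k)) (Q ^+ (_ * _)) => x y z hx.
  by field.
rewrite -(big_mkord xpredT (fun k => g k.+1 - g k)) telescope_sumr //.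
rewrite /g qbin0 qbinn subnn mul0n !subn0 mulnC.
by rewrite exprS; ring.
Qed.

Definition dcoef k : F := Q * Q ^- k * qnum k.

Lemma dcoef0 : dcoef 0 = 0.
Proof. by rewrite /dcoef /qnum !expr0 invr1 subrr mul0r mulr0. Qed.

Lemma dcoefS k : dcoef k.+1 = dcoef k + Q ^- (k + k).
Proof.
rewrite /dcoef /qnum !exprD !exprS.
have := Qn (isT : (0 < 2)%N); rewrite expr2 -subr_eq0.
have := expf_neq0 k Q0; have := Q0.
move: (Q ^+ k) Q => y x x0 y0 h.
by field; rewrite x0 y0 h.
Qed.

Lemma dcoef_shift m k : (k <= m)%N ->
  qbin m.+1 k * dcoef (m.+1 - k) =
  qbin m.+1 k.+1 * (Q ^+ m * Q ^- ((m - k) + (m - k)) * dcoef k.+1).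
Proof.
move=> km; rewrite /dcoef.
have := qbin_shift (km : (k < m.+1)%N) => hs.
transitivity (Q * Q ^- (m.+1 - k) * (qbin m.+1 k * qnum (m.+1 - k))).
  by ring.
rewrite hs -[in Q ^+ m](subnK km) subSn // exprD !exprS exprD.
have := expf_neq0 k Q0; have := expf_neq0 (m - k) Q0; have := Q0.
move: (qbin _ _) (qnum _) => a b.
move: (Q ^+ k) (Q ^+ (m - k)) Q => x y z z0 y0 x0.
by field; rewrite x0 y0 z0.
Qed.

Lemma dcoef_cancel m k : (k <= m)%N ->
  (-1) ^+ k * qbin m.+1 k * dcoef (m.+1 - k) +
  (-1) ^+ k.+1 * qbin m.+1 k.+1 *
    (Q ^+ m * Q ^- ((m - k) + (m - k)) * dcoef k.+1) = 0.
Proof. by move=> km; rewrite -mulrA dcoef_shift // exprS; ring. Qed.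
End QNumbers.

(* The constructions below are made over a field F with a chosen element v,
   which plays the role of q^{1/2}. *)

Section QPowers.
Variables (F : fieldType) (v : F).

(* q^r for a half-integer r; all exponents that occur are integers. *)
Definition qpow (r : rat) : F := v ^ Num.floor (2 * r).

Definition generic : Prop := v != 0 /\ forall n, (0 < n)%N -> v ^+ n != 1.

Hypothesis v0 : v != 0.

Lemma qpow_int (z : int) : qpow z%:~R = (v ^+ 2) ^ z.
Proof.
rewrite /qpow -[2]/(2%:~R) -intrM intrKfloor.
by rewrite -exprz_exp.
Qed.

Lemma qpowD_int r (z : int) : qpow (z%:~R + r) = (v ^+ 2) ^ z * qpow r.
Proof.
rewrite {1}/qpow mulrDr -[2 in X in X + _]/(2%:~R) -intrM floorDzr ?intr_int //.
by rewrite intrKfloor expfzDr // -exprz_exp.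
Qed.

Lemma qpow_int_pos r (k : nat) : r = k%:R -> qpow r = (v ^+ 2) ^+ k.
Proof. by move->; rewrite -[k%:R]/((k%:Z)%:~R) qpow_int. Qed.

Lemma qpow_int_neg r (k : nat) : r = - k%:R -> qpow r = (v ^+ 2) ^- k.
Proof.
by move->; rewrite -[k%:R]/((k%:Z)%:~R) -intrN qpow_int exprnN.
Qed.

End QPowers.

Section BosonicExtension.
Variables (F : fieldType) (v : F) (I : choiceType) (D : root_datum I).
Local Notation qpow := (qpow v).
Implicit Types (i j : I) (m p : int).

Definition qi i : F := qpow (wform (simple_root D i) (simple_root D i) / 2).

(* The exponent 1 - <h_i, alpha_j> is a nonnegative integer when i <> j. *)
Definition serre (A : lalgType F) i j (x y : A) : A :=
  let n := `|1 - simple_coroot D i (simple_root D j)|%N in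
  \sum_(k < n.+1)
    ((-1) ^+ k * qbin (qi i) n k) *: (x ^+ k * y * x ^+ (n - k)).

(* U^-_{q^{1/2}}(g) by the presentation of U_q^-(g) with scalars extended from
   Q(q) to Q(q^{1/2}). *)

Inductive Uminus_rel : freealg F I -> Prop :=
| Uminus_serre i j : i <> j -> Uminus_rel (serre i j (gen F i) (gen F j)).

Definition Uminus := palg Uminus_rel.
HB.instance Definition _ := GRing.PzRing.on Uminus.
HB.instance Definition _ := GRing.Lmodule.on Uminus.

Definition Upi : freealg F I -> Uminus := @ppi _ _ Uminus_rel.
HB.instance Definition _ := GRing.Linear.on Upi.

Definition f_ i : Uminus := Upi (gen F i).

Definition wt_word (w : seq I) : weight D := - \sum_(j <- w) simple_root D j.

Definition supp_wt (b : weight D) (X : freealg F I) : Prop :=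
  forall w, w \in msupp X -> wt_word w = b.

Definition homogeneous (b : weight D) (x : Uminus) : Prop :=
  exists2 X, supp_wt b X & x = Upi X.

Definition is_estar i (e : {linear Uminus -> Uminus}) : Prop :=
  [/\ e 1 = 0,
      forall j, e (f_ j) = (i == j)%:R
    & forall b c x y, homogeneous b x -> homogeneous c y ->
        e (x * y) = x * e y + qpow (wform (simple_root D i) c) *: (e x * y)].

Hypothesis vgen : generic v.
Let v0 : v != 0. Proof. by case: vgen. Qed.

Definition word (w : seq I) : freealg F I := locked << FMonom w >>.

Lemma wordE w : word w = << FMonom w >>. Proof. by rewrite /word -lock. Qed.

Lemma word_cat u w : word (u ++ w) = word u * word w.
Proof.
rewrite !wordE [RHS]malgM_def fgmulUU mulr1.
by have -> : mmul (FMonom u) (FMonom w) = FMonom (u ++ w) by exact: fmmulE.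
Qed.

Lemma word1 : word [::] = 1.
Proof. by rewrite wordE -fmoneE. Qed.

Lemma wordU i : word [:: i] = gen F i.
Proof. by rewrite wordE /gen fmuE. Qed.

Lemma word_cons i w : word (i :: w) = gen F i * word w.
Proof. by rewrite -wordU -word_cat. Qed.

Lemma word_nseq k i : word (nseq k i) = gen F i ^+ k.
Proof. by elim: k => [|k IH]; rewrite ?word1 // exprS -IH -word_cons. Qed.

Lemma word_monom (w : {fmonom I}) : << w >> = word w.
Proof. by rewrite wordE fmK. Qed.

Lemma wt_cat u w : wt_word (u ++ w) = wt_word u + wt_word w.
Proof. by rewrite /wt_word big_cat opprD. Qed.

Lemma form0l x : wform (0 : weight D) x = 0.
Proof. by apply: (addIr (wform 0 x)); rewrite -formDl !add0r. Qed.

Lemma formDr x (y z : weight D) : wform x (y + z) = wform x y + wform x z.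
Proof. by rewrite formC formDl !(formC x). Qed.

Lemma form0r x : wform x (0 : weight D) = 0.
Proof. by rewrite formC form0l. Qed.

Lemma formNr x (y : weight D) : wform x (- y) = - wform x y.
Proof.
by apply/eqP; rewrite -addr_eq0 -formDr addNr form0r.
Qed.

Lemma form_rootE i j :
  wform (simple_root D i) (simple_root D j) =
  (simple_coroot D i (simple_root D j))%:~R
    * wform (simple_root D i) (simple_root D i) / 2.
Proof.
have : wform (simple_root D i) (simple_root D i) != 0.
  have [n n0 ->] := form_root D i.
  by rewrite pnatr_eq0 muln_eq0 /= -lt0n.
by rewrite coroot_form => h; field.
Qed.

Lemma form_root_int i j : exists z : int,
  wform (simple_root D i) (simple_root D j) = z%:~R.
Proof.
rewrite form_rootE; have [n n0 ->] := form_root D i.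
exists (simple_coroot D i (simple_root D j) * n%:Z).
by rewrite intrM natrM -[n%:~R]/(n%:R); field.
Qed.

Lemma form_wt_int i w : exists z : int,
  wform (simple_root D i) (wt_word w) = z%:~R.
Proof.
elim: w => [|j w [z IH]]; first by exists 0; rewrite /wt_word big_nil oppr0 form0r.
have [y hy] := form_root_int i j; exists (- y + z).
rewrite -cat1s wt_cat formDr IH /wt_word big_seq1 formNr hy.
by rewrite intrD intrN.
Qed.

Lemma qpow_wt_cat i u w :
  qpow (wform (simple_root D i) (wt_word (u ++ w))) =
  qpow (wform (simple_root D i) (wt_word u)) * qpow (wform (simple_root D i) (wt_word w)).
Proof.
rewrite wt_cat formDr; have [z ->] := form_wt_int i u.
by rewrite (qpowD_int v0) qpow_int.
Qed.

Fixpoint dword i (w : seq I) : freealg F I :=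
  if w is j :: w' then
    gen F j * dword i w' +
    (i == j)%:R *: (qpow (wform (simple_root D i) (wt_word w')) *: word w')
  else 0.

Lemma dword_cat i u w : dword i (u ++ w) =
  word u * dword i w +
  qpow (wform (simple_root D i) (wt_word w)) *: (dword i u * word w).
Proof.
elim: u => [|j u IH] /=; first by rewrite word1 mul1r mul0r scaler0 addr0.
rewrite IH qpow_wt_cat word_cat word_cons; exact: (twist_step (@malg_scalerAr _ _)).
Qed.

Definition fd i (X : freealg F I) : freealg F I := lext (fun w : {fmonom I} => dword i w) X.
Lemma fd_linear i : linear (fd i). Proof. exact: lext_linear. Qed.
HB.instance Definition _ i :=
  GRing.isLinear.Build F (freealg F I) (freealg F I) _ (fd i) (fd_linear i).

Lemma fd_word i w : fd i (word w) = dword i w.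
Proof. by rewrite wordE /fd lextU scale1r. Qed.

Lemma word_decomp (X : freealg F I) : X = \sum_(w <- msupp X) X@_w *: word w.
Proof. by rewrite {1}[X]malg_decomp; apply: eq_bigr => w _; rewrite word_monom. Qed.

Lemma fdM_word i X w : fd i (X * word w) =
  X * dword i w + qpow (wform (simple_root D i) (wt_word w)) *: (fd i X * word w).
Proof.
rewrite [X]word_decomp; apply: twist_suml => u.
by rewrite /= -word_cat !fd_word dword_cat.
Qed.

Lemma fdM i c X Y : supp_wt c Y -> fd i (X * Y) =
  X * fd i Y + qpow (wform (simple_root D i) c) *: (fd i X * Y).
Proof.
move=> hY; rewrite [Y]word_decomp.
apply: (twist_sumr (@malg_scalerAr _ _)) => w hw.
by rewrite /= fdM_word fd_word (hY _ hw).
Qed.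

Lemma wt_nseq k i x :
  wform x (wt_word (nseq k i)) = - (k%:R * wform x (simple_root D i)).
Proof.
elim: k => [|k IH]; first by rewrite /wt_word big_nil oppr0 form0r mul0r oppr0.
rewrite -[nseq _ _]/([:: i] ++ nseq k i) wt_cat formDr IH /wt_word big_seq1.
by rewrite formNr -natr1; ring.
Qed.

Lemma qiP i : exists2 d : nat, (0 < d)%N &
  wform (simple_root D i) (simple_root D i) = (2 * d)%:R /\ qi i = (v ^+ 2) ^+ d.
Proof.
have [d d0 hd] := form_root D i; exists d => //; split=> //.
rewrite /qi hd natrM [2 * _]mulrC mulfK // -[d%:R]/((d%:Z)%:~R) qpow_int.
by [].
Qed.

Lemma qi_neq0 i : qi i != 0.
Proof. by have [d _ [_ ->]] := qiP i; rewrite !expf_neq0 //. Qed.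

Lemma qi_Xn_neq1 i n : (0 < n)%N -> qi i ^+ n != 1.
Proof.
move=> n0; have [d d0 [_ ->]] := qiP i.
by rewrite -!exprM vgen.2 // !muln_gt0 d0.
Qed.

Lemma qpow_ii i k :
  qpow (wform (simple_root D i) (wt_word (nseq k i))) = qi i ^- (k + k).
Proof.
have [d _ [hd ->]] := qiP i; rewrite wt_nseq hd -exprM.
by apply: qpow_int_neg; rewrite !natrM natrD; ring.
Qed.

Section Pair.
Variables (i j : I) (m : nat).
Hypothesis hm : simple_coroot D i (simple_root D j) = - m%:Z.

Lemma form_ij d : wform (simple_root D i) (simple_root D i) = (2 * d)%:R ->
  wform (simple_root D i) (simple_root D j) = - (m * d)%:R.
Proof.
move=> hd; rewrite form_rootE hm hd intrN !natrM -[m%:~R]/(m%:R : rat).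
by field.
Qed.

Lemma qpow_ji k :
  qpow (wform (simple_root D j) (wt_word (nseq k i))) = qi i ^+ (k * m).
Proof.
have [d _ [hd ->]] := qiP i; rewrite wt_nseq formC (form_ij hd) -exprM.
by apply: qpow_int_pos; rewrite !natrM; ring.
Qed.

Lemma qpow_ij : qpow (wform (simple_root D i) (wt_word [:: j])) = qi i ^+ m.
Proof.
have [d _ [hd ->]] := qiP i; rewrite -[[:: j]]/(nseq 1 j) wt_nseq (form_ij hd).
by rewrite -exprM; apply: qpow_int_pos; rewrite !natrM; ring.
Qed.

End Pair.

Lemma dword_notin l w : l \notin w -> dword l w = 0.
Proof.
elim: w => //= j w IH; rewrite inE negb_or => /andP[/negPf -> /IH ->].
by rewrite mulr0 scale0r addr0.
Qed.

Lemma dword_nseq i k : dword i (nseq k i) = dcoef (qi i) k *: word (nseq k.-1 i).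
Proof.
elim: k => [|k IH] /=; first by rewrite dcoef0 scale0r.
rewrite IH eqxx scale1r qpow_ii (dcoefS (qi_neq0 i) (qi_Xn_neq1 i)) scalerDl; congr (_ + _).
rewrite -malg_scalerAr; case: k {IH} => [|k] /=; first by rewrite dcoef0 !scale0r.
by rewrite -word_cons.
Qed.

Lemma coroot_nat i j : i <> j ->
  exists m : nat, simple_coroot D i (simple_root D j) = - m%:Z.
Proof.
move=> ij; have := gcm_offdiag (cartanP D) ij; rewrite -coroot_root => h.
exists `|simple_coroot D i (simple_root D j)|%N.
by rewrite abszE ler0_norm // opprK.
Qed.

Lemma wt_swap (k l : nat) i j : wt_word (nseq k i ++ j :: nseq l i) =
  wt_word (nseq (k + l) i) + wt_word [:: j].
Proof. by rewrite nseqD -cat1s !wt_cat addrCA addrC. Qed.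

Section Serre.
Variables (i j : I) (m : nat).
Hypothesis ij : i <> j.
Hypothesis hm : simple_coroot D i (simple_root D j) = - m%:Z.
Let w k l := word (nseq k i ++ j :: nseq l i).

Lemma serre_word : serre i j (gen F i) (gen F j) =
  \sum_(k < m.+2) ((-1) ^+ k * qbin (qi i) m.+1 k) *: w k (m.+1 - k).
Proof.
rewrite /serre hm opprK -[1 + _]/((m.+1)%:Z) absz_nat.
by apply: eq_bigr => k _; rewrite /w word_cat word_cons !word_nseq mulrA.
Qed.

Lemma serre_wt :
  exists c, supp_wt c (serre i j (gen F i) (gen F j)).
Proof.
exists (wt_word (nseq m.+1 i) + wt_word [:: j]) => u; rewrite serre_word.
rewrite -mcoeff_neq0 raddf_sum /=; set T := BIG_F => nz.
have [k hk] : exists k, T k != 0.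
  apply/existsP; apply: contraR nz; rewrite negb_exists => /forallP h.
  by rewrite big1 // => k _; move/negPn/eqP: (h k).
move: hk; rewrite /T mcoeffZ mulf_eq0 negb_or => /andP[_].
rewrite /w wordE mcoeffU1; have [<- _|_] := eqVneq _ u; last by rewrite eqxx.
have kn : (k <= m.+1)%N by case: k {T nz}.
by have := wt_swap k (m.+1 - k) i j; rewrite subnKC.
Qed.

Lemma dword_w_j k l : dword j (nseq k i ++ j :: nseq l i) =
  qi i ^+ (l * m) *: word (nseq (k + l) i).
Proof.
have jn n : j \notin nseq n i.
  by rewrite mem_nseq negb_and; apply/orP; right; apply/eqP => h; case: ij.
rewrite dword_cat (dword_notin (jn k)) mul0r scaler0 addr0 /=.
rewrite (dword_notin (jn l)) mulr0 add0r eqxx scale1r (qpow_ji hm).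
by rewrite -malg_scalerAr -word_cat nseqD.
Qed.

Lemma dword_w_i k l : dword i (nseq k i ++ j :: nseq l i) =
  dcoef (qi i) l *: w k l.-1 +
  (qi i ^+ m * qi i ^- (l + l) * dcoef (qi i) k) *: w k.-1 l.
Proof.
rewrite dword_cat [dword i (j :: _)]/= (introF eqP ij) !dword_nseq.
rewrite (twist_aux (@malg_scalerAr _ _)) -word_cons -!word_cat.
by rewrite -[j :: nseq l i]/([:: j] ++ _) qpow_wt_cat (qpow_ij hm) qpow_ii.
Qed.

Lemma fd_serre l : fd l (serre i j (gen F i) (gen F j)) = 0.
Proof.
rewrite serre_word linear_sum /=.
under eq_bigr do rewrite linearZ /= fd_word.
have [->|li] := eqVneq l i; last first.
  have [->|lj] := eqVneq l j; last first.
    rewrite big1 // => k _; rewrite dword_notin ?scaler0 //.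
    rewrite mem_cat inE !mem_nseq (negPf li) (negPf lj).
    by rewrite !andbF.
  rewrite -[RHS](scale0r (word (nseq m.+1 i))).
  rewrite -(qbin_alt_sum (qi_neq0 i) (qi_Xn_neq1 i) m) scaler_suml.
  apply: eq_bigr => k _; rewrite dword_w_j scalerA subnKC //.
  by case: k.
under eq_bigr do rewrite dword_w_i scale_comb.
apply: (@shift_sum _ _ m
  (fun k => (-1) ^+ k * qbin (qi i) m.+1 k * dcoef (qi i) (m.+1 - k))
  (fun k => (-1) ^+ k * qbin (qi i) m.+1 k *
    (qi i ^+ m * qi i ^- ((m.+1 - k) + (m.+1 - k)) * dcoef (qi i) k))
  (fun k => w k (m.+1 - k).-1) (fun k => w k.-1 (m.+1 - k))).
- by rewrite subnn dcoef0 mulr0.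
- by rewrite dcoef0 !mulr0.
move=> k km; rewrite subSS -subnS subSS; split=> //.
exact: (dcoef_cancel (qi_neq0 i) (qi_Xn_neq1 i)).
Qed.

End Serre.

Lemma fdD l X Y : fd l (X + Y) = fd l X + fd l Y.
Proof. exact: linearD. Qed.

Lemma fd_idealM l X Y : in_ideal Uminus_rel X ->
  in_ideal Uminus_rel (fd l X) -> in_ideal Uminus_rel (fd l (X * Y)).
Proof.
move=> hX hdX; rewrite [Y]word_decomp mulr_sumr linear_sum /=.
apply: (smod_sum (W := ideal Uminus_rel)) => w.
rewrite -malg_scalerAr linearZ /= fdM_word.
apply: (smodZ (W := ideal Uminus_rel)); apply: in_idealD.
  exact: in_idealMr.
by apply: (smodZ (W := ideal Uminus_rel)); exact: in_idealMr.
Qed.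

Lemma fd_ideal l X : in_ideal Uminus_rel X -> in_ideal Uminus_rel (fd l X).
Proof.
elim=> [|x r y z hr hz IH]; first by rewrite linear0; exact: in_ideal0.
rewrite fdD; apply: (in_idealD _ IH).
have ideal_r t : in_ideal Uminus_rel (t * r).
  by rewrite -[t * r]addr0 -[t * r]mulr1; apply: in_idealP => //; exact: in_ideal0.
apply: fd_idealM; first exact: ideal_r.
case: hr ideal_r => i j ij ideal_r; have [m hm] := coroot_nat ij.
have [c hc] := serre_wt hm.
rewrite (fdM _ _ hc) (fd_serre ij hm) mulr0 add0r.
exact: (smodZ (W := ideal Uminus_rel)).
Qed.

Lemma Upi_M X Y : Upi (X * Y) = Upi X * Upi Y.
Proof. exact: ppiM. Qed.

Lemma UpiDZ X a Y : Upi (X + a *: Y) = Upi X + a *: Upi Y.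
Proof. by rewrite addrC linearP addrC. Qed.

Lemma Upi_surj (x : Uminus) : exists X, x = Upi X.
Proof. exact: ppi_surj. Qed.

Lemma Upi1 : Upi 1 = 1. Proof. by []. Qed.

Lemma homogeneous_word w : homogeneous (wt_word w) (Upi (word w)).
Proof.
exists (word w) => // u; rewrite wordE -mcoeff_neq0 mcoeffU1.
by have [<- _|_] := eqVneq _ u; last by rewrite eqxx.
Qed.

Lemma estar_exists i : exists e : {linear Uminus -> Uminus}, is_estar i e.
Proof.
pose phi (X : freealg F I) : Uminus := Upi (fd i X).
have phi_lin : linear phi by move=> a X Y; rewrite /phi !linearP.
pose L := GRing.isLinear.Build F (freealg F I) Uminus _ phi phi_lin.
pose phiL : {linear freealg F I -> Uminus} := HB.pack phi L.
have [x hx|e0 he0] := @qlift_exists _ _ (ideal Uminus_rel) Uminus phiL.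
  by apply/qpi_eq0; exact: fd_ideal.
pose e : {linear Uminus -> Uminus} := e0.
have eE X : e (Upi X) = Upi (fd i X) by exact: he0.
exists e; split.
- by rewrite -Upi1 eE -word1 fd_word linear0.
- move=> j; rewrite /f_ eE -wordU fd_word /= mulr0 add0r word1.
  rewrite /wt_word big_nil oppr0 form0r.
  have -> : qpow 0 = 1 by rewrite -[0]/(0%:~R) qpow_int.
  by rewrite scale1r linearZ /= Upi1 scaler_nat.
move=> b c _ _ [X _ ->] [Y hY ->].
by rewrite -Upi_M !eE (fdM _ _ hY) UpiDZ !Upi_M.
Qed.

Lemma estar_unique i (e e' : {linear Uminus -> Uminus}) :
  is_estar i e -> is_estar i e' -> e =1 e'.
Proof.
move=> [e1 ef eM] [e1' ef' eM'] x; have [X ->] := Upi_surj x.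
rewrite [X]word_decomp !linear_sum /=; apply: eq_bigr => w _.
rewrite !linearZ /=; congr (_ *: _).
elim: {w}(w : seq I) => [|j w IH]; first by rewrite word1 Upi1 e1 e1'.
have hj : homogeneous (wt_word [:: j]) (f_ j).
  by rewrite /f_ -wordU; exact: homogeneous_word.
have hw := homogeneous_word w.
by rewrite word_cons Upi_M (eM _ _ _ _ hj hw) (eM' _ _ _ _ hj hw) IH ef ef'.
Qed.

Definition estar i : {linear Uminus -> Uminus} := sval (cid (estar_exists i)).

Lemma estarP i : is_estar i (estar i).
Proof. exact: svalP (cid (estar_exists i)). Qed.

Inductive Ahat_rel : freealg F (I * int)%type -> Prop :=
| Ahat_serre i j p : i <> j ->
    Ahat_rel (serre i j (gen F (i, p)) (gen F (j, p)))
| Ahat_comm i j m p : m < p ->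
    Ahat_rel
      (gen F (i, m) * gen F (j, p)
       - qpow ((-1) ^ (p - m + 1) * wform (simple_root D i) (simple_root D j))
           *: (gen F (j, p) * gen F (i, m))
       - (((j, p) == (i, m + 1))%:R * (1 - qi i ^+ 2))%:A).

Definition Ahat := palg Ahat_rel.
HB.instance Definition _ := GRing.PzRing.on Ahat.
HB.instance Definition _ := GRing.Lmodule.on Ahat.

Definition fhat i m : Ahat := pgen Ahat_rel (i, m).

Record Ahat_action (M : lmodType F) (act : Ahat -> M -> M) : Prop := AhatAction {
  act_linear_l : forall x, linear (act^~ x);
  act_linear_r : forall a, linear (act a);
  act_1 : forall x, act 1 x = x;
  act_M : forall a b x, act (a * b) x = act a (act b x)
}.

(* U_Z is the union of the finite tensor products U_b (x) ... (x) U_a along the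
   insertions of 1, that is, the quotient of the free F-module on the families
   u with u_k = 1 for all but finitely many k by multilinearity in each u_k. *)

Definition tensor := {fsfun int -> Uminus with 1}.

Inductive multilinear_rel : {malg F[tensor]} -> Prop :=
| Multilinear (u : tensor) k a x y :
    multilinear_rel
      (<< [fsfun u with k |-> a *: x + y] >>
       - a *: << [fsfun u with k |-> x] >> - << [fsfun u with k |-> y] >>).

Definition UZ := quot (spanned multilinear_rel).
HB.instance Definition _ := GRing.Lmodule.on UZ.

Definition pure (u : tensor) : UZ := qpi (spanned multilinear_rel) << u >>.

Definition alpha i m : weight D := simple_root D i *~ (-1) ^ m.

(* The weight of the partial tensor of the u_k with k >= n, where wt k is the
   weight of u_k; factors equal to 1 have weight 0. *)
Definition wthat_ge (n : int) (wt : int -> weight D) (u : tensor) : weight D :=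
  \sum_(k <- finsupp u | n <= k) wt k *~ (-1) ^ k.

End BosonicExtension.

Definition Kq : fieldType := {fraction {poly rat}}.
Definition qhalf : Kq := tofrac 'X.

Lemma qhalf_generic : generic qhalf.
Proof.
split=> [|n n0]; first by rewrite tofrac_eq0 polyX_eq0.
rewrite /qhalf -tofracXn -tofrac1 tofrac_eq.
apply/eqP => /(congr1 (fun p : {poly rat} => size p)).
by rewrite size_polyXn size_poly1 => -[] /eqP; rewrite eqn0Ngt n0.
Qed.

(* Main.v *)
Require Import Defs.
From HB Require Import structures.
From mathcomp Require Import all_boot all_order all_algebra.
From mathcomp Require Import finmap.
From mathcomp Require Import generic_quotient ring zify boolp.
From mathcomp.multinomials Require Import monalg.

Import Order.TTheory GRing.Theory Num.Theory.
Local Open Scope ring_scope.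

(** The generators act by operators on finite tensors that differ from the
identity in slots m and m+1 and, above them, only by the diagonal operators
K_i.  Write L_i for left multiplication by f_i on U^-, write E_i for e_i^*, and
let K_i^a multiply an element of weight b by q^(a (alpha_i, b)).  Up to the
scalar -(1 - q_i^-2), f_(i,m) is the sum of a lowering term, with E_i K_i^-1 in
slot m+1, and a raising term, with L_i in slot m and K_i^-1 in slot m+1; both
carry K_i^((-1)^(k-m)) in every slot k > m+1.  So the claim is that these
operators satisfy the relations of the bosonic extension.

The relations between two levels m < p are checked slot by slot, using
   K_i L_j = q^(-(alpha_i, alpha_j)) L_j K_i,
   K_i E_j = q^(alpha_i, alpha_j) E_j K_i,
   E_i L_j = L_j E_i + delta_ij K_i.
Each pair of terms q-commutes through one slot of level p, except that for
p = m+1 the lowering term at m meets the raising term at m+1 in the same slot.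
There the last identity leaves the extra delta_ij, and the factors K_i above
cancel, so that a scalar remains (act_comm).

The Serre relations at one level m could be deduced from those of the L_i and
of the E_i by a coproduct computation.  A shorter argument treats both terms
together.  Split f_(i,m) as far_act after near_act, where far_act carries the
K_i above slot m+1.  These far factors commute with everything at level m, so
it suffices to kill the Serre element S in the near factors.  Let Lambda_j be
left multiplication by f_j in slot m+1.  Moving a word w in the near factors
past Lambda_j produces Lambda_j w, rescaled, and the word operator of a
skew-derivative of w (word_act_add_at).  This skew-derivation is the lift of
e_j^* to the free algebra with q replaced by q^-1.  It kills S, because e_j^*
is well defined on U^- and the Serre coefficients are invariant under
q -> q^-1.  Hence S commutes with every Lambda_j up to a scalar.  As slot m+1
is spanned by products of the f_j, only tensors with 1 in that slot matter, and
on those S acts by the Serre relation of U^- in slot m (serre_near).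

The argument only uses a vacuum vector, the three commutation relations, and
the universal property of the tensor space, so it is carried out for abstract
modules V in place of U^- and M in place of U_Z (oscillator_module) and then
specialised. *)

(** * Modules over algebras given by generators and relations *)

Section FreeAction.
Set Implicit Arguments.
Unset Strict Implicit.
Unset Printing Implicit Defensive.
Variables (K : fieldType) (G : choiceType) (M : lmodType K).
Variable g : G -> {linear M -> M}.
Local Notation freealg := (freealg K G).

(** The leftmost letter acts last, so that concatenation of words is composition
    of operators. *)
Definition word_act (w : seq G) (x : M) : M := foldr (fun s y => g s y) x w.

Lemma word_act_linear w : linear (word_act w).
Proof. by move=> a x y; elim: w => //= s w ->; rewrite linearP. Qed.
HB.instance Definition _ w := GRing.isLinear.Build K M M _ (word_act w) (word_act_linear w).
Lemma word_actZ w a x : word_act w (a *: x) = a *: word_act w x.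
Proof. exact: linearZ. Qed.

Definition free_act (x : M) (X : freealg) : M :=
  lext (fun w : {fmonom G} => word_act w x) X.
Lemma free_act_linear x : linear (free_act x). Proof. exact: lext_linear. Qed.
HB.instance Definition _ x :=
  GRing.isLinear.Build K freealg M _ (free_act x) (free_act_linear x).

Lemma free_actZ x a X : free_act x (a *: X) = a *: free_act x X.
Proof. exact: linearZ. Qed.

Lemma free_actB x X Y : free_act x (X - Y) = free_act x X - free_act x Y.
Proof. exact: raddfB. Qed.

Lemma free_act_word x w : free_act x (word K w) = word_act w x.
Proof. by rewrite wordE /free_act lextU scale1r. Qed.

Lemma free_act_sum x X : free_act x X = \sum_(w <- msupp X) X@_w *: word_act w x.
Proof. by []. Qed.

Lemma free_act_linear_r X : linear (free_act^~ X).
Proof.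
move=> a x y; rewrite !free_act_sum scaler_sumr -big_split /=; apply: eq_bigr => w _.
by rewrite word_act_linear scalerDr !scalerA mulrC.
Qed.

Lemma free_act0 X : free_act 0 X = 0.
Proof. by rewrite free_act_sum big1 // => w _; rewrite linear0 scaler0. Qed.

Lemma free_act1 x : free_act x 1 = x.
Proof. by rewrite -word1 free_act_word. Qed.

Lemma free_act_gen x s : free_act x (gen K s) = g s x.
Proof. by rewrite -wordU free_act_word. Qed.

Lemma free_actM x X Y : free_act x (X * Y) = free_act (free_act x Y) X.
Proof.
rewrite [X]word_decomp mulr_suml !linear_sum; apply: eq_bigr => u _.
rewrite -scalerAl /= !free_actZ; congr (_ *: _).
rewrite [Y]word_decomp mulr_sumr !linear_sum /= free_act_word linear_sum.
apply: eq_bigr => w _.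
rewrite -malg_scalerAr /= !free_actZ -word_cat !free_act_word word_actZ.
by congr (_ *: _); rewrite /word_act foldr_cat.
Qed.

Lemma free_actX x s n : free_act x (gen K s ^+ n) = iter n (g s) x.
Proof.
elim: n => [|n IH]; first by rewrite expr0 free_act1.
by rewrite exprS free_actM free_act_gen IH.
Qed.

Lemma free_act_comm x s t c d :
  free_act x (gen K s * gen K t - c *: (gen K t * gen K s) - d%:A) =
  g s (g t x) - c *: g t (g s x) - d *: x.
Proof.
have gg a b : free_act x (gen K a * gen K b) = g a (g b x) by rewrite free_actM !free_act_gen.
rewrite free_actB; congr (_ - _); last by rewrite free_actZ free_act1.
by rewrite free_actB gg; congr (_ - _); rewrite free_actZ gg.
Qed.

Variable R : freealg -> Prop.
Hypothesis free_actR : forall r x, R r -> free_act x r = 0.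

(** The annihilator of the whole module is a two-sided ideal, which is why the
    relators have to be killed at every vector and not just at x. *)
Lemma free_act_ideal z x : in_ideal R z -> free_act x z = 0.
Proof.
move=> hz; elim: hz x => [|a r b y Rr _ IH] x; first exact: linear0.
by rewrite linearD /= IH addr0 !free_actM (free_actR _ Rr) free_act0.
Qed.

Definition palg_act (a : palg R) (x : M) : M := free_act x (repr a).

Lemma palg_actE X x : palg_act (ppi R X) x = free_act x X.
Proof.
apply/eqP; rewrite -subr_eq0 -linearB /=; apply/eqP.
exact: free_act_ideal (@repr_qpi _ _ (ideal R) X).
Qed.

Lemma palg_act_linear_l x : linear (palg_act^~ x).
Proof.
move=> a y z; have [[Y ->] [Z ->]] := conj (ppi_surj y) (ppi_surj z).
by rewrite -linearP !palg_actE linearP.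
Qed.

Lemma palg_actM a b x : palg_act (a * b) x = palg_act a (palg_act b x).
Proof.
have [[X ->] [Y ->]] := conj (ppi_surj a) (ppi_surj b).
by rewrite -ppiM !palg_actE free_actM.
Qed.

Lemma palg_act_gen s x : palg_act (pgen R s) x = g s x.
Proof. by rewrite palg_actE free_act_gen. Qed.

Lemma palg_act1 x : palg_act 1 x = x.
Proof. by rewrite -(ppi1 R) palg_actE free_act1. Qed.

End FreeAction.

(** * Powers of q *)

Section Characters.
Set Implicit Arguments.
Unset Strict Implicit.
Unset Printing Implicit Defensive.
Variables (F : fieldType) (v : F) (I : choiceType) (D : root_datum I).
Hypothesis v0 : v != 0.
Implicit Types (i j : I).

(** The scalar q^(alpha_i, x). *)
Definition qform i (x : weight D) : F := qpow v (wform (simple_root D i) x).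

(** The integrality that makes x |-> q^(alpha_i, x) a character of the whole
    weight lattice: (alpha_i, x) is <h_i, x> times half of (alpha_i, alpha_i). *)
Lemma form_int i (x : weight D) : exists z : int, wform (simple_root D i) x = z%:~R.
Proof.
have [d d0 hd] := form_root D i; exists (simple_coroot D i x * d%:Z).
rewrite intrM coroot_form hd natrM -[(d%:Z)%:~R]/(d%:R : rat).
by field; rewrite pnatr_eq0 -lt0n d0.
Qed.

Lemma qformD i x y : qform i (x + y) = qform i x * qform i y.
Proof.
rewrite /qform Defs.formDr; have [z ->] := form_int i x.
by rewrite (qpowD_int v0) qpow_int.
Qed.

Lemma qform0 i : qform i 0 = 1.
Proof. by rewrite /qform Defs.form0r -[0]/(0%:~R) qpow_int. Qed.

Lemma qform_neq0 i x : qform i x != 0.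
Proof. by rewrite /qform; apply: expfz_neq0. Qed.

Lemma qformN i x : qform i (- x) = (qform i x)^-1.
Proof.
apply: (mulIf (qform_neq0 i x)); rewrite -qformD addNr qform0 mulVf //.
exact: qform_neq0.
Qed.

Definition qroot i j : F := qform i (simple_root D j).

Lemma qrootC i j : qroot i j = qroot j i.
Proof. by rewrite /qroot /qform Defs.formC. Qed.

Lemma qroot_neq0 i j : qroot i j != 0. Proof. exact: qform_neq0. Qed.

Lemma qform_cons i j w : qform i (wt_word D (j :: w)) = (qroot i j)^-1 * qform i (wt_word D w).
Proof. by rewrite -cat1s wt_cat qformD /wt_word big_seq1 qformN. Qed.

Lemma qform_nil i : qform i (wt_word D [::]) = 1.
Proof. by rewrite /wt_word big_nil oppr0 qform0. Qed.

Lemma qiE i : qi v D i ^+ 2 = qroot i i.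
Proof.
have [d _ [hd ->]] := qiP v D i.
by rewrite /qroot /qform hd (@qpow_int_pos _ v _ (2 * d)%N) // -exprM mulnC.
Qed.

(** The alternating sign, kept in int so that it can serve as an exponent. *)
Definition sg (z : int) : int := (-1) ^ z.

Lemma sgD y z : sg (y + z) = sg y * sg z.
Proof. by rewrite /sg exprzDr ?unitrN1. Qed.

Lemma sg1 : sg 1 = -1. Proof. by []. Qed.

Lemma sgN z : sg (- z) = sg z.
Proof. by rewrite /sg -exprz_inv. Qed.

Lemma sgS z : sg (z + 1) = - sg z.
Proof. by rewrite sgD sg1 mulrN1. Qed.

Lemma sgP z : sg z = 1 \/ sg z = -1.
Proof.
have sg_nat (n : nat) : sg n%:Z = 1 \/ sg n%:Z = -1.
  by rewrite /sg -[_ ^ _]/((-1) ^+ n) -signr_odd; case: odd; [right | left].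
by case: (intP z) => [|n|n]; [left | exact: sg_nat | rewrite sgN; exact: sg_nat].
Qed.

Lemma sg_rat z : (-1) ^ z = (sg z)%:~R :> rat.
Proof. by rewrite /sg rmorphXz ?unitrN1 // rmorphN1. Qed.

Lemma qform_sg i x z : qform i (x *~ sg z) = qform i x ^ sg z.
Proof. by case: (sgP z) => ->; rewrite ?mulr1z // mulrN1z qformN. Qed.

Lemma qpow_sign i x z :
  qpow v ((-1) ^ z * wform (simple_root D i) x) = qform i x ^ sg z.
Proof.
rewrite sg_rat -qform_sg /qform; case: (sgP z) => ->; first by rewrite mul1r mulr1z.
by rewrite !mulrN1z mulN1r Defs.formNr.
Qed.

(** This and the next three lemmas allow the skew-derivations of the free algebra to be used
    with v inverted while the Serre elements stay the same. *)
Lemma generic_inv : generic v -> generic v^-1.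
Proof.
case=> nz vn; split=> [|n /vn]; first by rewrite invr_eq0; exact: nz.
by rewrite exprVn invr_eq1.
Qed.

Lemma qpow_inv r : qpow v^-1 r = (qpow v r)^-1.
Proof. by rewrite /qpow exprz_inv invr_expz. Qed.

Lemma qbin_inv (Q : F) n k : qbin Q^-1 n k = qbin Q n k.
Proof.
have numE l : qnum Q^-1 l = qnum Q l.
  by rewrite /qnum invrK !exprVn invrK -opprB -(opprB Q) invrN mulrNN.
have qfE l : qfact Q^-1 l = qfact Q l.
  by rewrite /qfact; apply: eq_bigr => r _; rewrite numE.
by rewrite /qbin !qfE.
Qed.

Lemma serre_inv (A : lalgType F) i j (x y : A) :
  serre v^-1 D i j x y = serre v D i j x y.
Proof.
by apply: eq_bigr => k _; rewrite /qi qpow_inv qbin_inv.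
Qed.

End Characters.

(** * The oscillator relations on one tensor factor *)

Section Oscillators.
Set Implicit Arguments.
Unset Strict Implicit.
Unset Printing Implicit Defensive.
Variables (F : fieldType) (v : F) (I : choiceType) (D : root_datum I).
Hypothesis vgen : generic v.
Local Notation q := (qroot v D).
Let v0 : v != 0. Proof. by case: vgen. Qed.
Let qC := qrootC v D.
Let q0 : forall i j, q i j != 0 := qroot_neq0 D v0.
Implicit Types (i j : I) (a b : int).

(* V, one, L, E and K are modelled on U^-, its unit, left multiplication by the
   f_i, the e_i^* and the weight operators. *)
Variables (V : lmodType F) (one : V).
Variables (L E : I -> {linear V -> V}) (K : I -> int -> {linear V -> V}).
Hypothesis V_ind : forall P : V -> Prop,
  (forall c x y, P x -> P y -> P (c *: x + y)) -> P one ->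
  (forall j x, P x -> P (L j x)) -> forall x, P x.
Hypothesis K_one : forall i a, K i a one = one.
Hypothesis K_L : forall i a j x, K i a (L j x) = q i j ^ (- a) *: L j (K i a x).
Hypothesis E_one : forall i, E i one = 0.
Hypothesis E_L : forall i j x,
  E i (L j x) = L j (E i x) + (i == j)%:R *: K i 1 x.

(** This and the next three relations follow by induction over products of the
    L_j applied to the vacuum, on which K_L and E_L determine K and E. *)
Lemma K_add i a b x : K i a (K i b x) = K i (a + b) x.
Proof.
elim/V_ind: x => [c x y hx hy||j x hx]; first by rewrite !linearP hx hy.
  by rewrite !K_one.
by rewrite K_L linearZ /= !K_L hx scalerA -expfzDr // -opprD [b + a]addrC.
Qed.

Lemma K_zero i x : K i 0 x = x.
Proof.
elim/V_ind: x => [c x y hx hy||j x hx]; first by rewrite !linearP hx hy.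
  by rewrite !K_one.
by rewrite K_L hx oppr0 scale1r.
Qed.

Lemma K_comm i j a b x : K i a (K j b x) = K j b (K i a x).
Proof.
elim/V_ind: x => [c x y hx hy||k x hx]; first by rewrite !linearP hx hy.
  by rewrite !K_one.
by rewrite !K_L !linearZ /= !K_L hx !scalerA mulrC.
Qed.

Lemma K_E i a j x : K i a (E j x) = q i j ^ a *: E j (K i a x).
Proof.
elim/V_ind: x => [c x y hx hy||k x hx].
- by rewrite !linearP hx hy.
- by rewrite K_one !E_one linear0 scaler0.
rewrite K_L linearZ /= !E_L linearD linearZ /= K_L hx (K_comm i j).
rewrite !scalerDr linearZ !scalerA /=; congr (_ *: _ + _ *: _).
  by rewrite mulrC.
have [->|_] := eqVneq j k; last by rewrite !mulr0.
by rewrite mulr1 -expfzDr // subrr expr0z.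
Qed.

(** K_i^-1 acts first because the twist in f_(i,m) involves the weight of the
    factor before e_i^* is applied to it. *)
Definition lower i : {linear V -> V} := E i \o K i (-1).

Lemma lowerE i x : lower i x = E i (K i (-1) x). Proof. by []. Qed.

Lemma lower_one i : lower i one = 0.
Proof. by rewrite lowerE K_one E_one. Qed.

Lemma lower_L i j x :
  lower i (L j x) = q i j *: L j (lower i x) + (q i j * (i == j)%:R) *: x.
Proof.
rewrite !lowerE K_L linearZ /= E_L K_add subrr K_zero.
by rewrite scalerDr scalerA opprK expr1z.
Qed.

Lemma K_lower i a j x : K i a (lower j x) = q i j ^ a *: lower j (K i a x).
Proof. by rewrite !lowerE K_E (K_comm i j). Qed.

(** * Slotwise operators on the tensor space *)

(* M is modelled on the infinite tensor product: it is spanned by pure tensors,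
   and multilinear maps on pure tensors extend to it. *)
Local Notation tensor := {fsfun int -> V with one}.
Implicit Types (u : tensor) (k l m p : int).

Variables (M : lmodType F) (pure : tensor -> M).
Hypothesis pureP : forall u k c x y,
  pure [fsfun u with k |-> c *: x + y] =
  c *: pure [fsfun u with k |-> x] + pure [fsfun u with k |-> y].
Hypothesis M_ind : forall P : M -> Prop,
  (forall c x y, P x -> P y -> P (c *: x + y)) -> P 0 ->
  (forall u, P (pure u)) -> forall x, P x.
Hypothesis M_lift : forall h : tensor -> M,
  (forall u k c x y, h [fsfun u with k |-> c *: x + y] =
    c *: h [fsfun u with k |-> x] + h [fsfun u with k |-> y]) ->
  exists e : {linear M -> M}, forall u, e (pure u) = h u.

Lemma pure_comb u k c d x y :
  pure [fsfun u with k |-> c *: x + d *: y] =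
  c *: pure [fsfun u with k |-> x] + d *: pure [fsfun u with k |-> y].
Proof.
rewrite pureP; congr (_ + _).
have h0 : pure [fsfun u with k |-> 0] = 0.
  by apply: (addIr (pure [fsfun u with k |-> 0])); rewrite -{1}[pure _]scale1r -pureP scaler0 !add0r.
by rewrite -[d *: y]addr0 pureP h0 addr0.
Qed.

Lemma pureZ u k c x :
  pure [fsfun u with k |-> c *: x] = c *: pure [fsfun u with k |-> x].
Proof. by rewrite -[c *: x]addr0 -[0](scale0r x) pure_comb scale0r addr0. Qed.

Lemma pure0 u k : u k = 0 -> pure u = 0.
Proof. by move=> uk; rewrite -[u](fsfun_with_id u k) uk -(scale0r 0) pureZ scale0r. Qed.

(** A family of linear maps, one for each tensor factor, all but finitely many of
    which fix the vacuum; this is what makes their tensor product act on families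
    with almost all entries equal to the vacuum. *)
Record slots := Slots {
  slot :> int -> V -> V;
  slot_linear : forall k, linear (slot k);
  slot_exc : {fset int};
  slot_one : forall k, k \notin slot_exc -> slot k one = one
}.
Implicit Types (S T R : slots).

Definition sapp S u : tensor :=
  [fsfun k in (finsupp u `|` slot_exc S)%fset => S k (u k)].

Lemma sappE S u k : sapp S u k = S k (u k).
Proof.
rewrite fsfun_fun; case: ifP => //; rewrite inE => /negbT.
by rewrite negb_or => /andP[hu hS]; rewrite (fsfun_dflt hu) slot_one.
Qed.

Lemma sapp_with S u k x :
  sapp S [fsfun u with k |-> x] = [fsfun sapp S u with k |-> S k x].
Proof.
apply/fsfunP => l; rewrite sappE !fsfun_withE sappE.
by case: eqP => [->|].
Qed.

Lemma tens_exists S :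
  exists e : {linear M -> M}, forall u, e (pure u) = pure (sapp S u).
Proof.
apply: (M_lift (h := fun u => pure (sapp S u))) => u k c x y.
by rewrite !sapp_with slot_linear pureP.
Qed.

Definition tens S : {linear M -> M} := sval (cid (tens_exists S)).

Lemma tensE S u : tens S (pure u) = pure (sapp S u).
Proof. exact: svalP (cid (tens_exists S)) u. Qed.

(** Multilinearity in the k-th operator.  All relations below are reduced to one
    slot through this lemma. *)
Lemma tens_comb k c d S T R x :
  (forall l y, l != k -> S l y = T l y /\ S l y = R l y) ->
  (forall y, S k y = c *: T k y + d *: R k y) ->
  tens S x = c *: tens T x + d *: tens R x.
Proof.
move=> hl hk; elim/M_ind: x => [e x y hx hy||u].
- rewrite !linearP hx hy !scalerDr !scalerA addrACA.
  by rewrite (mulrC e c) (mulrC e d).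
- by rewrite !linear0 addr0.
have hS : sapp S u = [fsfun sapp S u with k |-> c *: T k (u k) + d *: R k (u k)].
  by rewrite -hk -sappE fsfun_with_id.
rewrite !tensE hS pure_comb; congr (_ *: pure _ + _ *: pure _);
  apply/fsfunP => l; rewrite fsfun_withE !sappE;
  by case: eqVneq => [->//|/hl-/(_ (u l))[]].
Qed.

Lemma tens_scale k c S T x :
  (forall l y, l != k -> S l y = T l y) -> (forall y, S k y = c *: T k y) ->
  tens S x = c *: tens T x.
Proof.
move=> hl hk; rewrite (@tens_comb k c 0 S T T) ?scale0r ?addr0 //.
  by move=> l y lk; rewrite hl.
by move=> y; rewrite hk scale0r addr0.
Qed.

Lemma eq_tens S T x : (forall l y, S l y = T l y) -> tens S x = tens T x.
Proof. by move=> h; rewrite (@tens_scale 0 1 S T) ?scale1r // => *; rewrite h ?scale1r. Qed.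

Lemma slot_id_linear (k : int) : linear (@idfun V). Proof. by []. Qed.
Definition slot_id : slots :=
  @Slots (fun _ => idfun) slot_id_linear fset0 (fun _ _ => erefl).

Lemma tens_id S x : (forall l y, S l y = y) -> tens S x = x.
Proof.
move=> h; elim/M_ind: x => [c x y hx hy||u]; first by rewrite linearP hx hy.
  by rewrite linear0.
by rewrite tensE; congr pure; apply/fsfunP => l; rewrite sappE h.
Qed.

Lemma scomp_linear S T k : linear (S k \o T k).
Proof. by move=> c x y; rewrite /= !slot_linear. Qed.
Lemma scomp_one S T k :
  k \notin (slot_exc S `|` slot_exc T)%fset -> (S k \o T k) one = one.
Proof.
by rewrite inE negb_or => /andP[hS hT]; rewrite /= (slot_one hT) (slot_one hS).
Qed.
Definition scomp S T : slots := Slots (scomp_linear S T) (@scomp_one S T).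

Lemma tens_comp S T x : tens S (tens T x) = tens (scomp S T) x.
Proof.
elim/M_ind: x => [c x y hx hy||u]; first by rewrite !linearP hx hy.
  by rewrite !linear0.
by rewrite !tensE; congr pure; apply/fsfunP => l; rewrite !sappE.
Qed.

Lemma tens_qcomm k c S T x :
  (forall l y, l != k -> S l (T l y) = T l (S l y)) ->
  (forall y, S k (T k y) = c *: T k (S k y)) ->
  tens S (tens T x) = c *: tens T (tens S x).
Proof. by move=> hl hk; rewrite !tens_comp; apply: (@tens_scale k). Qed.

Lemma tens_comm S T x :
  (forall l y, S l (T l y) = T l (S l y)) -> tens S (tens T x) = tens T (tens S x).
Proof. by move=> h; rewrite !tens_comp; apply: eq_tens => l y; apply: h. Qed.

(** * The generators and the relations between different levels *)

Definition at_fun k (X : V -> V) l : V -> V := if l == k then X else idfun.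
Lemma at_linear k (X : {linear V -> V}) l : linear (at_fun k X l).
Proof. by rewrite /at_fun; case: eqP => _ c x y //; rewrite linearP. Qed.
Lemma at_one k (X : {linear V -> V}) l : l \notin [fset k]%fset -> at_fun k X l one = one.
Proof. by rewrite inE /at_fun => /negPf ->. Qed.
Definition at_slot k (X : {linear V -> V}) : slots := Slots (at_linear k X) (@at_one k X).

(** The exponent is relative to m, whereas the support k < l is a separate
    parameter: the raising term carries K_i from slot m+1 on, the lowering term
    only from slot m+2 on. *)
Definition above_fun i k m l : V -> V := if k < l then K i (sg (l - m)) else idfun.
Lemma above_linear i k m l : linear (above_fun i k m l).
Proof. by rewrite /above_fun; case: ifP => _ c x y //; rewrite linearP. Qed.
Lemma above_one i k m l : l \notin fset0 -> above_fun i k m l one = one.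
Proof. by rewrite /above_fun => _; case: ifP => // _; rewrite K_one. Qed.
Definition above i k m : slots := Slots (above_linear i k m) (@above_one i k m).

Lemma at_slotE k X l x : at_slot k X l x = if l == k then X x else x.
Proof. by rewrite /= /at_fun; case: eqP. Qed.
Lemma aboveE i k m l x : above i k m l x = if k < l then K i (sg (l - m)) x else x.
Proof. by rewrite /= /above_fun; case: ifP. Qed.
Opaque at_slot above.

Definition lowering_slots i m : slots := scomp (above i (m + 1) m) (at_slot (m + 1) (lower i)).
Definition raising_slots i m : slots := scomp (above i m m) (at_slot m (L i)).

Lemma lowering_slotsE i m l x : lowering_slots i m l x =
  if l == m + 1 then lower i x else if m + 1 < l then K i (sg (l - m)) x else x.
Proof.
by rewrite [LHS]/= aboveE at_slotE; case: eqP => // ->; rewrite ltxx.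
Qed.

Lemma raising_slotsE i m l x : raising_slots i m l x =
  if l == m then L i x else if m < l then K i (sg (l - m)) x else x.
Proof.
by rewrite [LHS]/= aboveE at_slotE; case: eqP => // ->; rewrite ltxx.
Qed.
Opaque lowering_slots raising_slots.

(** Since q i i is q_i^2, this is the coefficient -(1 - q_i^-2). *)
Definition lcoef i : F := - (1 - (q i i)^-1).

Definition act_fun i m x : M :=
  lcoef i *: tens (lowering_slots i m) x + tens (raising_slots i m) x.
Lemma act_linear i m : linear (act_fun i m).
Proof.
by move=> c x y; rewrite /act_fun !linearP /= addrACA !scalerA (mulrC c).
Qed.
HB.instance Definition _ i m := GRing.isLinear.Build F M M _ (act_fun i m) (act_linear i m).
Definition act i m : {linear M -> M} := locked (act_fun i m : {linear M -> M}).

Lemma actE i m x : act i m x = lcoef i *: tens (lowering_slots i m) x + tens (raising_slots i m) x.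
Proof. by rewrite /act -lock. Qed.

(** Both terms of f_(i,m) act by powers of K_i far above m.  There they meet the
    terms of f_(j,p), and only the slot of the latter that lowers or raises
    contributes a scalar; the sign of its exponent is the parity of its distance
    to m, flipped once more for a raising slot. *)
Lemma qcomm_lowering i m j p S x :
  (forall l y, p < l -> S l y = K i (sg (l - m)) y) ->
  tens S (tens (lowering_slots j p) x) = q i j ^ sg (p - m + 1) *: tens (lowering_slots j p) (tens S x).
Proof.
move=> hS; apply: (@tens_qcomm (p + 1)) => [l y lp|y]; rewrite 2!lowering_slotsE.
  rewrite (negPf lp); case: ifP; last by [].
  by move=> pl; rewrite 2?hS 1?K_comm; [|lia..].
by rewrite eqxx 2?hS ?K_lower 1?addrAC; [|lia..].
Qed.

Lemma qcomm_raising i m j p S x :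
  (forall l y, p <= l -> S l y = K i (sg (l - m)) y) ->
  tens S (tens (raising_slots j p) x) = q i j ^ sg (p - m + 1) *: tens (raising_slots j p) (tens S x).
Proof.
move=> hS; apply: (@tens_qcomm p) => [l y lp|y]; rewrite 2!raising_slotsE.
  rewrite (negPf lp); case: ifP; last by [].
  by move=> pl; rewrite 2?hS 1?K_comm; [|lia..].
by rewrite eqxx 2?hS ?K_L 1?sgS; [|lia..].
Qed.

Lemma lowering_slots_above i m l y : m + 1 < l -> lowering_slots i m l y = K i (sg (l - m)) y.
Proof. by move=> h; rewrite lowering_slotsE (gt_eqF h) h. Qed.

Lemma raising_slots_above i m l y : m < l -> raising_slots i m l y = K i (sg (l - m)) y.
Proof. by move=> h; rewrite raising_slotsE (gt_eqF h) h. Qed.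

(** The only pair of terms that may act nontrivially in the same slot: for
    p = m+1, slot m+1 is lowered by the first and raised by the second.  When also
    i = j, the powers of K_i above that slot are opposite and cancel, so that the
    correction is a scalar. *)
Lemma lowering_raising i m j p x : m < p ->
  tens (lowering_slots i m) (tens (raising_slots j p) x) =
  q i j ^ sg (p - m + 1) *: tens (raising_slots j p) (tens (lowering_slots i m) x) +
  (((j, p) == (i, m + 1))%:R * q i i) *: x.
Proof.
move=> mp; have [->|pm] := eqVneq p (m + 1); last first.
  rewrite xpair_eqE (negPf pm) andbF mul0r scale0r addr0.
  by apply: qcomm_raising => l y pl; apply: lowering_slots_above; lia.
have -> : sg (m + 1 - m + 1) = 1 by rewrite [m + 1]addrC addrK sgD mulrNN.
rewrite expr1z xpair_eqE eqxx andbT.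
have [->|ji] := eqVneq j i; last first.
  rewrite mul0r scale0r addr0.
  apply: (@tens_qcomm (m + 1)) => [l y lm|y]; rewrite !lowering_slotsE !raising_slotsE.
    by rewrite (negPf lm); case: (m + 1 < l) => //; rewrite K_comm.
  rewrite eqxx lower_L eq_sym (negPf ji) mulr0 scale0r addr0 //.
(* The correction is written as the tensor product of identity maps, so that it
   agrees with the products outside slot m+1. *)
rewrite mul1r -[in RHS](@tens_id slot_id x) // !tens_comp.
apply: (@tens_comb (m + 1)) => [l y lm|y].
  rewrite /= !lowering_slotsE !raising_slotsE (negPf lm).
  case: (m + 1 < l) => //; rewrite !K_add.
  have -> : l - m = (l - (m + 1)) + 1 by lia.
  by rewrite sgS subrr addrC subrr K_zero.
by rewrite /= !lowering_slotsE !raising_slotsE eqxx lower_L eqxx mulr1.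
Qed.

Lemma act_comm i j m p x : m < p ->
  act i m (act j p x) =
  q i j ^ sg (p - m + 1) *: act j p (act i m x) +
  (((j, p) == (i, m + 1))%:R * (1 - q i i)) *: x.
Proof.
move=> mp; rewrite !actE !linearD !linearZ /=.
rewrite lowering_raising // (@qcomm_lowering i m j p (lowering_slots i m)); last first.
  by move=> l y pl; apply: lowering_slots_above; lia.
rewrite (@qcomm_lowering i m j p (raising_slots i m)); last first.
  by move=> l y pl; apply: raising_slots_above; lia.
rewrite (@qcomm_raising i m j p (raising_slots i m)); last first.
  by move=> l y pl; apply: raising_slots_above; lia.
(* Collect the four q-commuted products in front of the scalar correction. *)
rewrite scalerDr [LHS](AC ((1*2)*2) ((1*4)*(2*5)*3)) /=; congr (_ + _).
rewrite scalerA; congr (_ *: _); rewrite mulrCA; congr (_ * _).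
by rewrite /lcoef; field; rewrite q0.
Qed.

(** * The Serre relations at one level *)

Definition pair_slots i m : slots := scomp (at_slot (m + 1) (K i (-1))) (at_slot m (L i)).

Lemma pair_slotsE i m l x : pair_slots i m l x =
  if l == m + 1 then K i (-1) x else if l == m then L i x else x.
Proof.
rewrite [LHS]/= !at_slotE; case: eqP => // ->.
by rewrite gt_eqF ?ltrDl.
Qed.

Opaque pair_slots.

Definition near_act_fun i m x : M :=
  lcoef i *: tens (at_slot (m + 1) (lower i)) x + tens (pair_slots i m) x.
Lemma near_act_linear i m : linear (near_act_fun i m).
Proof. by move=> c x y; rewrite /near_act_fun !linearP /= addrACA !scalerA (mulrC c). Qed.
HB.instance Definition _ i m := GRing.isLinear.Build F M M _ (near_act_fun i m) (near_act_linear i m).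
Definition near_act i m : {linear M -> M} := locked (near_act_fun i m : {linear M -> M}).

Lemma near_actE i m x : near_act i m x =
  lcoef i *: tens (at_slot (m + 1) (lower i)) x + tens (pair_slots i m) x.
Proof. by rewrite /near_act -lock. Qed.

Definition far_act i m : {linear M -> M} := tens (above i (m + 1) m).

(** Separating the factors above slot m+1 makes the commutator with add_at below a
    scalar instead of a multiple of those factors. *)
Lemma act_split i m x : act i m x = far_act i m (near_act i m x).
Proof.
rewrite actE near_actE /far_act linearP !tens_comp; congr (_ *: _ + _).
apply: eq_tens => l y.
rewrite raising_slotsE [RHS]/= aboveE pair_slotsE.
have [->|lm] := eqVneq l m.
  have mm : m < m + 1 by rewrite ltrDl.
  by rewrite (lt_eqF mm) (le_gtF (ltW mm)).
have [->|lm1] := eqVneq l (m + 1).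
  by rewrite ltxx ltrDl addrC addKr.
by have -> : (m < l) = (m + 1 < l) by lia.
Qed.

Lemma far_comm i j m x : far_act i m (far_act j m x) = far_act j m (far_act i m x).
Proof.
by apply: tens_comm => l y; rewrite !aboveE; case: (m + 1 < l) => //; rewrite K_comm.
Qed.

Lemma far_near_comm i j m x : far_act i m (near_act j m x) = near_act j m (far_act i m x).
Proof.
rewrite !near_actE /far_act linearP; congr (_ *: _ + _);
  apply: tens_comm => l y; rewrite 2!aboveE ?at_slotE ?pair_slotsE.
  by case: ltP => // /gt_eqF->.
case: ltP => // h; rewrite (gt_eqF h) gt_eqF //.
by apply: lt_trans h; rewrite ltrDl.
Qed.

Lemma near_iter_far i j m n x :
  near_act j m (iter n (far_act i m) x) = iter n (far_act i m) (near_act j m x).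
Proof. by elim: n => //= n <-; rewrite far_near_comm. Qed.

Lemma far_iter_far i j m n x :
  far_act j m (iter n (far_act i m) x) = iter n (far_act i m) (far_act j m x).
Proof. by elim: n => //= n <-; rewrite far_comm. Qed.

Lemma iter_act i m n x : iter n (act i m) x = iter n (far_act i m) (iter n (near_act i m) x).
Proof. by elim: n => //= n ->; rewrite act_split near_iter_far. Qed.

(** Every value of slot m+1 is reached from the vacuum by these operators. *)
Definition add_at j m : {linear M -> M} := tens (at_slot (m + 1) (L j)).

Lemma near_add_at i j m x : near_act i m (add_at j m x) =
  q j i *: add_at j m (near_act i m x) + ((j == i)%:R * (1 - q j j)) *: x.
Proof.
rewrite !near_actE /add_at linearP.
have -> : tens (at_slot (m + 1) (lower i)) (tens (at_slot (m + 1) (L j)) x) =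
  q j i *: tens (at_slot (m + 1) (L j)) (tens (at_slot (m + 1) (lower i)) x) +
  (q i j * (i == j)%:R) *: tens slot_id x.
  rewrite !tens_comp; apply: (@tens_comb (m + 1)) => [l y /negPf lm|y] /=.
    by rewrite !at_slotE lm.
  by rewrite !at_slotE eqxx lower_L qC.
rewrite (@tens_id slot_id) // (@tens_qcomm (m + 1) (q j i) (pair_slots i m)); first last.
- by move=> y; rewrite !pair_slotsE !at_slotE eqxx K_L opprK expr1z qC.
- by move=> l y /negPf lm; rewrite !at_slotE lm.
rewrite !scalerDr !scalerA addrAC [lcoef i * q j i]mulrC; congr (_ + _ *: _).
rewrite eq_sym; have [->|_] := eqVneq j i; last by rewrite mulr0 mulr0 mul0r.
by rewrite /lcoef; field; rewrite q0.
Qed.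

Lemma tens_at k (X : {linear V -> V}) u :
  tens (at_slot k X) (pure u) = pure [fsfun u with k |-> X (u k)].
Proof.
rewrite tensE; congr pure; apply/fsfunP => l; rewrite sappE fsfun_withE at_slotE.
by case: eqP => [->|].
Qed.

(** The lowering term dies on the vacuum, so that near_act is just left
    multiplication in slot m. *)
Lemma near_vac i m u : u (m + 1) = one ->
  near_act i m (pure u) = pure [fsfun u with m |-> L i (u m)].
Proof.
move=> um; rewrite near_actE tens_at (@pure0 _ (m + 1)) ?scaler0 ?add0r; last first.
  by rewrite fsfun_with um lower_one.
rewrite tensE; congr pure; apply/fsfunP => l; rewrite sappE fsfun_withE pair_slotsE.
have [->|_] := eqVneq l (m + 1); last by case: eqP => [->|].
by rewrite um K_one; case: eqP => // mm; have := ltrDl m 1; rewrite mm ltxx.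
Qed.

Section FixedSlot.
Variable m : int.
Local Notation g := (fun i => near_act i m).

(** The word operators obey the Leibniz rule that defines dword, but with q
    inverted: each letter of w that is moved past add_at costs q^(alpha_j, alpha_i),
    which is the inverse of what e_j^* acquires. *)
Lemma word_act_add_at j w x : word_act g w (add_at j m x) =
  (qform v j (wt_word D w))^-1 *: add_at j m (word_act g w x) +
  (1 - q j j) *: free_act g x (dword v^-1 D j w).
Proof.
elim: w => [|i w IH] /=.
  by rewrite qform_nil // invr1 scale1r linear0 scaler0 addr0.
rewrite IH linearP linearZ /= near_add_at qform_cons // invfM invrK.
rewrite (linearD (free_act g x)) (linearZZ (free_act g x)) /= free_actM free_act_gen linearZ /=.
rewrite free_act_word qpow_inv -/(qform v j _).
move: (near_act i m (free_act _ _ _)) => y; rewrite !scalerDr !scalerA -!addrA.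
rewrite (mulrC (q j i)) [X in _ + X]addrC; congr (_ + (_ + _ *: _)).
by rewrite mulrC (mulrC (1 - _)).
Qed.

Lemma free_act_add_at j (c : weight D) X x : supp_wt c X ->
  free_act g (add_at j m x) X =
  (qform v j c)^-1 *: add_at j m (free_act g x X) + (1 - q j j) *: free_act g x (fd v^-1 D j X).
Proof.
move=> hX; rewrite (free_act_sum _ _ X) (free_act_sum _ x X) /fd /lext (linear_sum (free_act g x)).
rewrite (linear_sum (add_at j m)) !scaler_sumr -big_split /=.
rewrite big_seq [RHS]big_seq; apply: eq_bigr => w /hX wc.
by rewrite word_act_add_at wc scalerDr !linearZ /= !scalerA !(mulrC X@_w).
Qed.

Lemma free_act_vac X u : u (m + 1) = one ->
  free_act g (pure u) X = pure [fsfun u with m |-> free_act L (u m) X].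
Proof.
move=> um; have mm : m + 1 == m = false.
  by apply/eqP => h; have := ltrDl m 1; rewrite h ltxx.
have wE w : word_act g w (pure u) = pure [fsfun u with m |-> word_act L w (u m)].
  elim: w => [|i w IH] /=; first by rewrite fsfun_with_id.
  rewrite IH [LHS]near_vac; last by rewrite fsfun_withE mm.
  rewrite fsfun_with; congr pure; apply/fsfunP => l.
  by rewrite !fsfun_withE; case: eqP.
rewrite !free_act_sum; under eq_bigr do rewrite wE.
(* The tensor on the right is linear in slot m, so the sum can be taken outside. *)
elim: (enum_fset (msupp X)) => [|w s IH]; last by rewrite !big_cons IH pureP.
by rewrite !big_nil (@pure0 _ m) // fsfun_with.
Qed.

Hypothesis serre_L : forall i j x, i <> j ->
  free_act L x (serre v D i j (gen F i) (gen F j)) = 0.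

(** Induction on slot m+1.  The Serre element is homogeneous and is killed by the
    skew-derivation, so it commutes with add_at up to a scalar; for the vacuum it
    reduces to the Serre relation on V. *)
Lemma serre_near i j x : i <> j ->
  free_act g x (serre v D i j (gen F i) (gen F j)) = 0.
Proof.
move=> ij; have [n hn] := coroot_nat D ij.
set X := serre _ _ _ _ _ _.
have [c hc] : exists c : weight D, supp_wt c X := serre_wt v hn.
have dX (l : I) : fd v^-1 D l X = 0.
  rewrite /X -serre_inv; exact: (fd_serre (generic_inv vgen) ij hn).
elim/M_ind: x => [e x y hx hy||u].
- by rewrite free_act_linear_r hx hy scaler0 addr0.
- exact: free_act0.
rewrite -[u](fsfun_with_id u (m + 1)); move: (u (m + 1)) => y.
elim/V_ind: y => [e y z hy hz||l y hy].
- by rewrite pureP free_act_linear_r hy hz scaler0 addr0.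
- rewrite free_act_vac ?fsfun_with // (@pure0 _ m) // fsfun_with serre_L //.
have -> : pure [fsfun u with m + 1 |-> L l y] =
    add_at l m (pure [fsfun u with m + 1 |-> y]).
  rewrite /add_at tens_at fsfun_with; congr pure; apply/fsfunP => k.
  by rewrite !fsfun_withE; case: eqP.
by rewrite (free_act_add_at _ _ hc) hy dX !linear0 addr0.
Qed.

(** Stated for arbitrary generators s and t, so that it serves both for the near
    factors and for the generators at level m. *)
Lemma free_act_serre (G : choiceType) (N : lmodType F) (h : G -> {linear N -> N}) i j s t y :
  let n := `|1 - simple_coroot D i (simple_root D j)|%N in
  free_act h y (serre v D i j (gen F s) (gen F t)) =
  \sum_(k < n.+1) ((-1) ^+ k * qbin (qi v D i) n k) *:
    iter k (h s) (h t (iter (n - k) (h s) y)).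
Proof.
move=> n; rewrite /serre linear_sum; apply: eq_bigr => k _ /=.
by rewrite linearZ /= !free_actM !free_actX free_act_gen.
Qed.

(** All terms of the Serre element contain the same letters, hence the same far
    factors, which can be pulled out of the sum. *)
Lemma serre_act i j x : i <> j ->
  free_act (fun s : I * int => act s.1 s.2) x
    (serre v D i j (gen F (i, m)) (gen F (j, m))) = 0.
Proof.
move=> ij; rewrite free_act_serre /=; set n := `|_|%N.
pose T : {linear M -> M} := far_act i m.
have iterT0 r : iter r T 0 = 0 by elim: r => //= r ->; rewrite linear0.
have iterTP r c y z : iter r T (c *: y + z) = c *: iter r T y + iter r T z.
  by elim: r => //= r ->; rewrite linearP.
have := serre_near x ij; rewrite free_act_serre -/n => /= h.
transitivity (iter n T (far_act j m 0)); last by rewrite linear0.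
rewrite -[in RHS]h linear_sum.
have -> (r : seq 'I_n.+1) (G : 'I_n.+1 -> M) :
    iter n T (\sum_(k <- r) G k) = \sum_(k <- r) iter n T (G k).
  elim: r => [|k r IH]; first by rewrite !big_nil.
  by rewrite !big_cons -[X in iter n T (X + _)]scale1r iterTP scale1r IH.
apply: eq_bigr => k _; rewrite linearZ /= -[X in iter n T X]addr0 iterTP iterT0 addr0.
congr (_ *: _); rewrite (iter_act i m (n - k)) act_split near_iter_far far_iter_far.
rewrite iter_act.
have Gtop y : iter k (near_act i m) (far_act j m y) = far_act j m (iter k (near_act i m) y).
  by elim: (k : nat) => //= r ->; rewrite far_near_comm.
have GT r y : iter k (near_act i m) (iter r T y) = iter r T (iter k (near_act i m) y).
  by elim: (k : nat) => //= s ->; rewrite near_iter_far.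
by rewrite GT Gtop -iterD subnKC // -ltnS.
Qed.

End FixedSlot.

Lemma free_act_Ahat r x :
  (forall i j y, i <> j -> free_act L y (serre v D i j (gen F i) (gen F j)) = 0) ->
  Ahat_rel v D r -> free_act (fun s : I * int => act s.1 s.2) x r = 0.
Proof.
move=> serre_L; case=> [i j p ij|i j m p mp]; first exact: serre_act.
rewrite free_act_comm /= act_comm //.
by rewrite qpow_sign // qiE // -[qform _ _ _]/(q i j) -addrA -opprD subrr.
Qed.

(** * The action on homogeneous pure tensors *)

Lemma pure_scale (c : int -> F) (s : seq int) u u' : uniq s ->
  (forall k, u' k = (if k \in s then c k else 1) *: u k) ->
  pure u' = (\prod_(k <- s) c k) *: pure u.
Proof.
elim: s u' => [|k s IH] u' /=.
  move=> _ h; rewrite big_nil scale1r; congr pure; apply/fsfunP => k.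
  by rewrite h scale1r.
case/andP=> ks us h; rewrite big_cons -scalerA -(IH [fsfun u' with k |-> u k] us).
  rewrite -pureZ; congr pure; apply/fsfunP => l; rewrite !fsfun_withE.
  by case: eqP => // ->; rewrite h inE eqxx.
move=> l; rewrite fsfun_withE; case: eqP => [->|/eqP lk].
  by rewrite (negPf ks) scale1r.
by rewrite h inE (negPf lk).
Qed.

(** The factors outside the support of u are equal to the vacuum, on which K is
    trivial; this is why the product over the support gives the full twist. *)
Lemma act_pure (c : int -> F) i m u :
  (forall k a, K i a (u k) = c k ^ a *: u k) ->
  act i m (pure u) =
  (\prod_(k <- finsupp u | m + 1 <= k) c k ^ sg (k - m)) *:
    (lcoef i *: pure [fsfun u with m + 1 |-> E i (u (m + 1))]
     + pure [fsfun u with m |-> L i (u m)]).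
Proof.
move=> hK; set S := [seq k <- finsupp u | m + 1 <= k].
have S_uniq : uniq S by rewrite filter_uniq ?fset_uniq.
have memS k : (k \in S) = (m + 1 <= k) && (k \in finsupp u) by rewrite mem_filter.
have out k : k \notin finsupp u -> u k = one by move/fsfun_dflt.
have topE k : m + 1 <= k ->
    K i (sg (k - m)) (u k) = (if k \in S then c k ^ sg (k - m) else 1) *: u k.
  move=> mk; rewrite memS mk /=; case: ifPn => [_|/out ->]; first by rewrite hK.
  by rewrite K_one scale1r.
rewrite -big_filter -/S actE !tensE scalerDr scalerA mulrC -scalerA.
congr (_ *: _ + _); apply: (@pure_scale (fun k => c k ^ sg (k - m))) => // k;
  rewrite sappE fsfun_withE.
- rewrite lowering_slotsE; have [->|km] := eqVneq k (m + 1).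
    have := topE (m + 1) (lexx _); rewrite [m + 1]addrC addrK sg1 lowerE => ->.
    by rewrite linearZ.
  case: ifP => [mk|mk]; first by rewrite topE // ltW.
  have -> : k \in S = false by rewrite memS; apply/negbTE/nandP; left; lia.
  by rewrite scale1r.
rewrite raising_slotsE; have [->|km] := eqVneq k m.
  have -> : m \in S = false by rewrite memS; apply/negbTE/nandP; left; lia.
  by rewrite scale1r.
case: ifP => [mk|mk]; first by rewrite topE //; lia.
have -> : k \in S = false by rewrite memS; apply/negbTE/nandP; left; lia.
by rewrite scale1r.
Qed.

Lemma qform_alpha i m (s : seq int) (P : pred int) (wt : int -> weight D) :
  qpow v (wform (alpha D i m) (\sum_(k <- s | P k) wt k *~ (-1) ^ k)) =
  \prod_(k <- s | P k) qform v i (wt k) ^ sg (k - m).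
Proof.
have sgE k : sg (k - m) = sg k * sg m by rewrite sgD sgN.
have -> : qpow v (wform (alpha D i m) (\sum_(k <- s | P k) wt k *~ (-1) ^ k)) =
    qform v i (\sum_(k <- s | P k) wt k *~ sg (k - m)).
  have -> : \sum_(k <- s | P k) wt k *~ sg (k - m) =
      (\sum_(k <- s | P k) wt k *~ (-1) ^ k) *~ sg m.
    by rewrite mulrz_suml; apply: eq_bigr => k _; rewrite sgE -mulrzA.
  rewrite /qform /alpha -/(sg m); case: (sgP m) => ->; first by rewrite !mulr1z.
  by rewrite !mulrN1z Defs.formNr Defs.formC Defs.formNr Defs.formC.
elim/big_rec2: _ => [|k x y _ IH]; first by rewrite qform0.
by rewrite qformD // qform_sg // IH.
Qed.

Hypothesis serre_L : forall i j x, i <> j ->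
  free_act L x (serre v D i j (gen F i) (gen F j)) = 0.

(** The weight of a factor enters only through the scalars by which the K_i act
    on it, so an ambiguous weight (that of 0) does no harm. *)
Theorem oscillator_module : exists act : Ahat v D -> M -> M,
  Ahat_action act /\
  forall i m u (wt : int -> weight D),
    (forall k a, K i a (u k) = qform v i (wt k) ^ a *: u k) ->
    act (fhat v D i m) (pure u) =
      qpow v (wform (alpha D i m)
        (\sum_(k <- finsupp u | m + 1 <= k) wt k *~ (-1) ^ k)) *:
      (- (1 - qi v D i ^- 2) *: pure [fsfun u with m + 1 |-> E i (u (m + 1))]
       + pure [fsfun u with m |-> L i (u m)]).
Proof.
pose g (s : I * int) := act s.1 s.2.
have gR r x : Ahat_rel v D r -> free_act g x r = 0 by exact: free_act_Ahat.
exists (palg_act g (R := Ahat_rel v D)); split.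
  split=> [x|a|x|a b x].
  - exact: palg_act_linear_l.
  - exact: free_act_linear_r.
  - exact: palg_act1.
  - exact: palg_actM.
move=> i m u wt hK; rewrite [LHS](palg_act_gen gR) /g /=.
by rewrite (act_pure (c := fun k => qform v i (wt k))) // qform_alpha /lcoef qiE.
Qed.

End Oscillators.

(** * The operators on U^- *)

(** Multiplicativity on spanning families suffices for a linear map. *)
Lemma linear_mul_sum (F : fieldType) (A : lalgType F)
    (scaleAr : forall a (x y : A), a *: (x * y) = x * (a *: y))
    (phi : {linear A -> A}) (S T : Type) (s : seq S) (t : seq T)
    (a : S -> F) (b : T -> F) (x : S -> A) (y : T -> A) :
  (forall u w, phi (x u * y w) = phi (x u) * phi (y w)) ->
  phi ((\sum_(u <- s) a u *: x u) * (\sum_(w <- t) b w *: y w)) =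
  phi (\sum_(u <- s) a u *: x u) * phi (\sum_(w <- t) b w *: y w).
Proof.
move=> xy; rewrite mulr_suml !linear_sum mulr_suml; apply: eq_bigr => u _ /=.
rewrite mulr_sumr linear_sum mulr_sumr; apply: eq_bigr => w _ /=.
by rewrite -scalerAl -scaleAr !linearZ /= xy -scalerAl -scaleAr.
Qed.

(** The universal property of a free module modulo relators, to be used for the
    tensor space. *)
Section SpanQuotient.
Variables (F : fieldType) (T : choiceType) (M : lmodType F) (h : T -> M).

Lemma lext_affine (c : F) (x y z : T) : h x = c *: h y + h z ->
  lext h (<< x >> - c *: << y >> - << z >>) = 0.
Proof.
move=> hx; rewrite !linearB linearZ /= !lextU !scale1r hx -addrA -opprD subrr //.
Qed.

Lemma span_quotient_lift (R : {malg F[T]} -> Prop) :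
  (forall r, R r -> lext h r = 0) ->
  exists e : {linear quot (spanned R) -> M}, forall u, e (qpi (spanned R) << u >>) = h u.
Proof.
move=> hR; pose phi : {linear {malg F[T]} -> M} := HB.pack (lext h)
  (GRing.isLinear.Build F {malg F[T]} M _ (lext h) (@lext_linear F T M h)).
have [X|e he] := @qlift_exists _ _ (spanned R) M phi.
  by elim=> [|a x y Rx _ hy]; rewrite ?linear0 // linearP hy addr0 /= hR // scaler0.
by exists e => u; rewrite he /= lextU scale1r.
Qed.

End SpanQuotient.

Section UminusOperators.
Set Implicit Arguments.
Unset Strict Implicit.
Unset Printing Implicit Defensive.
Variables (F : fieldType) (v : F) (I : choiceType) (D : root_datum I).
Hypothesis vgen : generic v.
Implicit Types (i j : I) (a b : int).
Let v0 : v != 0. Proof. by case: vgen. Qed.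

Local Notation U := (Uminus v D).
Local Notation f := (f_ v D).

(** The algebra automorphism of the free algebra that becomes K_i^a on U^-. *)
Definition weight_scale i a (X : freealg F I) : freealg F I :=
  lext (fun w : {fmonom I} => qform v i (wt_word D w) ^ a *: word F w) X.
Lemma weight_scale_linear i a : linear (weight_scale i a).
Proof. exact: lext_linear. Qed.
HB.instance Definition _ i a := GRing.isLinear.Build F (freealg F I) (freealg F I) _
  (weight_scale i a) (weight_scale_linear i a).

Lemma weight_scaleZ i a c X : weight_scale i a (c *: X) = c *: weight_scale i a X.
Proof. exact: linearZZ. Qed.

Lemma weight_scale_sum (T : Type) i a (r : seq T) (P : pred T) (X : T -> freealg F I) :
  weight_scale i a (\sum_(t <- r | P t) X t) =
  \sum_(t <- r | P t) weight_scale i a (X t).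
Proof. exact: linear_sum. Qed.

Lemma weight_scale_word i a w :
  weight_scale i a (word F w) = qform v i (wt_word D w) ^ a *: word F w.
Proof. by rewrite {1}wordE /weight_scale lextU scale1r. Qed.

Lemma weight_scaleM i a X Y :
  weight_scale i a (X * Y) = weight_scale i a X * weight_scale i a Y.
Proof.
rewrite [X]word_decomp [Y]word_decomp.
apply: (@linear_mul_sum _ _ (@malg_scalerAr F I) (weight_scale i a)
  _ _ _ _ _ _ (fun u : {fmonom I} => word F u) (fun w : {fmonom I} => word F w)) => u w.
rewrite /= -word_cat 3!weight_scale_word wt_cat qformD // word_cat.
rewrite -malg_scalerAr -scalerAl scalerA.
by rewrite mulrC exprzMl ?unitfE ?qform_neq0.
Qed.

Lemma weight_scale_supp i a (c : weight D) X : supp_wt c X ->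
  weight_scale i a X = qform v i c ^ a *: X.
Proof.
move=> hX; rewrite [X]word_decomp weight_scale_sum scaler_sumr big_seq [RHS]big_seq.
by apply: eq_bigr => w /hX wc; rewrite weight_scaleZ weight_scale_word wc !scalerA mulrC.
Qed.

(** Serre elements are homogeneous, so they are eigenvectors. *)
Lemma weight_scale_ideal i a X : in_ideal (Uminus_rel v D) X ->
  in_ideal (Uminus_rel v D) (weight_scale i a X).
Proof.
elim=> [|x r y z hr _ IH]; first by rewrite linear0; exact: in_ideal0.
have -> : weight_scale i a (x * r * y + z) = weight_scale i a (x * r * y) + weight_scale i a z.
  exact: raddfD.
apply: (in_idealD _ IH); rewrite 2!weight_scaleM; apply: in_idealMr; apply: in_idealMl.
case: hr => j k jk; have [m hm] := coroot_nat D jk.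
have [c hc] := serre_wt v hm.
rewrite (weight_scale_supp _ _ hc); apply: (smodZ (W := ideal (Uminus_rel v D))) => /=.
rewrite -[X in in_ideal _ X]addr0 -[X in X + _]mulr1 -[X in X * 1 + _]mul1r.
by apply: in_idealP; [exact: Uminus_serre | exact: in_ideal0].
Qed.

Lemma Kop_exists i a : exists k : {linear U -> U},
  forall X, k (Upi v D X) = Upi v D (weight_scale i a X).
Proof.
pose phi (X : freealg F I) : U := Upi v D (weight_scale i a X).
have phi_lin : linear phi by move=> c X Y; rewrite /phi !linearP.
pose phiL : {linear freealg F I -> U} :=
  HB.pack phi (GRing.isLinear.Build F (freealg F I) U _ phi phi_lin).
apply: (@qlift_exists _ _ (ideal (Uminus_rel v D)) U phiL) => x hx.
by apply/qpi_eq0; exact: weight_scale_ideal.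
Qed.

Definition Kop i a : {linear U -> U} := sval (cid (Kop_exists i a)).

Lemma Kop_pi i a X : Kop i a (Upi v D X) = Upi v D (weight_scale i a X).
Proof. exact: svalP (cid (Kop_exists i a)) X. Qed.

Lemma Kop_hom i a (c : weight D) x : homogeneous c x -> Kop i a x = qform v i c ^ a *: x.
Proof. by case=> X hX ->; rewrite Kop_pi (weight_scale_supp _ _ hX) linearZ. Qed.

(** The factor f_j has weight - alpha_j, whence the opposite exponent. *)
Lemma Kop_f i a j x : Kop i a (f j * x) = qroot v D i j ^ (- a) *: (f j * Kop i a x).
Proof.
have [X ->] := Upi_surj x.
rewrite Kop_pi -Upi_M Kop_pi weight_scaleM -wordU weight_scale_word.
rewrite qform_cons // qform_nil // mulr1.
by rewrite -scalerAl linearZ wordU -Upi_M exprz_inv.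
Qed.

Lemma Kop_one i a : Kop i a 1 = 1.
Proof.
rewrite -Upi1 -word1 Kop_pi weight_scale_word qform_nil // exp1rz.
by congr (Upi v D _); rewrite scale1r.
Qed.

Lemma fmul_linear i : linear (fun x : U => f i * x).
Proof. by move=> c x y; rewrite mulrDr palg_scalerAr. Qed.
Definition fmul i : {linear U -> U} :=
  HB.pack (fun x : U => f i * x)
    (GRing.isLinear.Build F U U _ (fun x : U => f i * x) (fmul_linear i)).

Lemma Uminus_word_ind (P : U -> Prop) :
  (forall c x y, P x -> P y -> P (c *: x + y)) -> P 0 ->
  (forall w, P (Upi v D (word F w))) -> forall x, P x.
Proof.
move=> Pc P0 Pw x; have [X ->] := Upi_surj x.
rewrite [X]word_decomp linear_sum; elim/big_rec: _ => // w y _ Py.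
by rewrite linearZ /=; apply: Pc.
Qed.

Lemma Uminus_ind (P : U -> Prop) :
  (forall c x y, P x -> P y -> P (c *: x + y)) -> P 1 ->
  (forall j x, P x -> P (fmul j x)) -> forall x, P x.
Proof.
move=> Pc P1 Pf; apply: Uminus_word_ind => [//||w].
  (* 0 = -1 + 1 *)
  by have := Pc (-1) _ _ P1 P1; rewrite scaleN1r addNr.
elim: w => [|j w IH]; first by rewrite word1.
by rewrite word_cons Upi_M; apply: (Pf j).
Qed.

Lemma estar_one i : estar D vgen i 1 = 0.
Proof. by have [] := estarP D vgen i. Qed.

(** This and skew_zero are the inductive steps of estar_fmul: both sides are
    linear in x. *)
Lemma skew_comb (V : lmodType F) (E L K : {linear V -> V}) (c d : F) x y :
  E (L x) = L (E x) + d *: K x -> E (L y) = L (E y) + d *: K y ->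
  E (L (c *: x + y)) = L (E (c *: x + y)) + d *: K (c *: x + y).
Proof.
by move=> hx hy; rewrite !linearP hx hy /= scalerDr addrACA.
Qed.

Lemma skew_zero (V : lmodType F) (E L K : {linear V -> V}) (d : F) :
  E (L 0) = L (E 0) + d *: K 0.
Proof. by rewrite !linear0 addr0. Qed.

(** The Leibniz rule of e_i^* with first factor f_j; the twist by the weight of the
    second factor is the operator K_i. *)
Lemma estar_fmul i j x :
  estar D vgen i (fmul j x) = fmul j (estar D vgen i x) + (i == j)%:R *: Kop i 1 x.
Proof.
move: x; apply: Uminus_word_ind => [c x y||w].
- exact: skew_comb.
- exact: skew_zero.
have [_ ef eM] := estarP D vgen i.
have hj : homogeneous (wt_word D [:: j]) (f j).
  by rewrite /f_ -wordU; exact: homogeneous_word.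
have hw := homogeneous_word v D w.
rewrite (Kop_hom _ _ hw); apply: etrans (eM _ _ _ _ hj hw) _.
rewrite ef mulr_natl -scaler_nat scalerA (mulrC _ _%:R) [in RHS]scalerA.
exact: erefl.
Qed.

Lemma free_act_fmul x X : free_act fmul x X = Upi v D X * x.
Proof.
have wE w : word_act fmul w x = Upi v D (word F w) * x.
  elim: w => [|j w IH]; first by rewrite word1 Upi1 mul1r.
  by rewrite word_cons Upi_M /= IH; exact: mulrA.
rewrite free_act_sum [X in RHS]word_decomp linear_sum mulr_suml; apply: eq_bigr => w _.
by rewrite linearZ wE /= palg_scalerAl.
Qed.

Lemma serre_fmul i j x : i <> j -> free_act fmul x (serre v D i j (gen F i) (gen F j)) = 0.
Proof.
move=> ij; rewrite free_act_fmul.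
have -> : Upi v D (serre v D i j (gen F i) (gen F j)) = 0.
  apply/qpi_eq0; rewrite -[X in in_sub _ X]addr0 -[X in X + _]mulr1 -[X in X * 1 + _]mul1r.
  by apply: in_idealP; [exact: Uminus_serre | exact: in_ideal0].
by rewrite mul0r.
Qed.

(** * The tensor space and the theorem *)

Local Notation tensor := (tensor v D).
Implicit Types (u : tensor).

Lemma pure_multilinear u (k : int) c (x y : U) :
  pure [fsfun u with k |-> c *: x + y] =
  c *: pure [fsfun u with k |-> x] + pure [fsfun u with k |-> y].
Proof.
pose W := spanned (@multilinear_rel F v I D).
have : qpi W (<< [fsfun u with k |-> c *: x + y] >>
    - c *: << [fsfun u with k |-> x] >> - << [fsfun u with k |-> y] >>) = 0.
  apply/qpi_eq0; rewrite -[X in in_sub _ X]addr0 -[X in X + _]scale1r.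
  by apply: in_spannedP; [exact: Multilinear | exact: in_spanned0].
rewrite !linearB linearZ /= => /eqP; rewrite subr_eq0 subr_eq [X in _ == X]addrC => /eqP.
exact.
Qed.

Lemma UZ_ind (P : UZ v D -> Prop) :
  (forall c x y, P x -> P y -> P (c *: x + y)) -> P 0 ->
  (forall u, P (pure u)) -> forall x, P x.
Proof.
move=> Pc P0 Pp x; have [X ->] := qpi_surj x.
rewrite [X]malg_decomp linear_sum; elim/big_rec: _ => // u y _ Py.
by rewrite linearZ /=; apply: Pc => //; apply: Pp.
Qed.

Lemma UZ_lift (M : lmodType F) (h : tensor -> M) :
  (forall u (k : int) c (x y : U), h [fsfun u with k |-> c *: x + y] =
    c *: h [fsfun u with k |-> x] + h [fsfun u with k |-> y]) ->
  exists e : {linear UZ v D -> M}, forall u, e (pure u) = h u.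
Proof.
move=> hM; apply: span_quotient_lift => r [u k c s t].
by apply: lext_affine; exact: hM.
Qed.

End UminusOperators.

Theorem theorem4p3 (I : choiceType) (D : root_datum I) :
  exists act : Ahat qhalf D -> UZ qhalf D -> UZ qhalf D,
    Ahat_action act /\
    forall (i : I) (m : int) (u : tensor qhalf D) (wt : int -> weight D),
      (forall k : int, homogeneous (wt k) (u k)) ->
      act (fhat qhalf D i m) (pure u) =
        qpow qhalf (wform (alpha D i m) (wthat_ge (m + 1) wt u)) *:
          (- (1 - qi qhalf D i ^- 2) *:
              pure [fsfun u with m + 1 |-> estar D qhalf_generic i (u (m + 1))]
           + pure [fsfun u with m |-> f_ qhalf D i * u m]).
Proof.
have [act [actP act_pure]] := @oscillator_module Kq qhalf I D qhalf_generic
  (Uminus qhalf D) 1 (@fmul _ qhalf _ D) (estar D qhalf_generic)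
  (Kop D qhalf_generic) (@Uminus_ind _ _ _ _)
  (@Kop_one _ _ _ _ qhalf_generic) (@Kop_f _ _ _ _ qhalf_generic)
  (@estar_one _ _ _ _ qhalf_generic) (@estar_fmul _ _ _ _ qhalf_generic)
  (UZ qhalf D) (@pure _ _ _ _) (@pure_multilinear _ _ _ _) (@UZ_ind _ _ _ _)
  (@UZ_lift _ _ _ _ (UZ qhalf D)) (@serre_fmul _ _ _ _).
exists act; split=> // i m u wt hu.
by apply: act_pure => k a; exact: Kop_hom.
Qed.
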